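(* Let $I$ be a non-empty open interval of $\mathbb{R}$ and let $\lambda_1,\lambda_2$ be probability measures on $\mathcal{B}_I$ of finite mean. Assume $\lambda_1$ has finite support; let $A:=\operatorname{supp}(\lambda_1)$ and $n:=|A|$. Then for any given measure $\nu$ on $\mathcal{B}_{I^2}$ the following are equivalent: (i) $\nu$ is a curtain martingale coupling of $\lambda_1$ and $\lambda_2$. (ii) There exists a bijection $J:\{1,\ldots,n\}\to A$ such that $\nu=\delta_{J(1)}\times\nu_1+\cdots+\delta_{J(n)}\times\nu_n$, where inductively, for $i\in\{1,\ldots,n\}$, $\nu_i$ is the unique connected part of $\lambda_2-(\nu_1+\cdots+\nu_{i-1})$ of mass $\lambda_1(\{J(i)\})$ and first moment $\lambda_1(\{J(i)\})J(i)$. Furthermore, if $\lambda_1$ and $\lambda_2$ are in convex order, then for each bijection $J:\{1,\ldots,n\}\to A$ there exists a (necessarily unique) $\nu$ satisfying (ii) with this $J$.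
   Context: $\mathcal{B}_A$ denotes the Borel $\sigma$-field of $A$; $\delta_x$ is the Dirac measure at $x$. $X_1,X_2$ are the canonical projections of $I^2$ onto the first and second coordinate. Convex order: probability measures $\lambda_1,\lambda_2$ on $\mathcal{B}_I$ of finite mean are in convex order if $\int\psi\,d\lambda_1\le\int\psi\,d\lambda_2$ for all convex $\psi:I\to\mathbb{R}$. A martingale coupling of $\lambda_1$ and $\lambda_2$ is a probability measure $\nu$ on $\mathcal{B}_{I^2}$ with first marginal $\lambda_1$, second marginal $\lambda_2$ and $E_\nu[X_2\mid X_1]=X_1$ $\nu$-a.s. A curtain martingale coupling of $\lambda_1$ and $\lambda_2$ is a martingale coupling $\nu$ of $\lambda_1$ and $\lambda_2$ for which there exists $\Gamma\in\mathcal{B}_{I^2}$ that carries $\nu$ (i.e. $\nu(\Gamma)=1$) and such that one cannot have $\{(x,y),(x,y_1),(x,y_2),(x',y'),(x',y_1'),(x',y_2')\}\subset\Gamma$ with $x\ne x'$, $y_1<y'<y_2$ and $y_1'<y<y_2'$. Connected part: for a finite measure $\gamma$ on $\mathcal{B}_I$ and reals $0\le a\le b\le\gamma(I)$, $\gamma_a^b$ is the unique measure $\rho$ on $\mathcal{B}_I$ with $\rho((-\infty,x]\cap I)=(\gamma((-\infty,x]\cap I)-a)^+\wedge(b-a)$ for all $x\in I$ (the restriction of $\gamma$ between the quantiles $a$ and $b$). A connected part of $\gamma$ is any measure of the form $\gamma_a^b$ with $0\le a\le b\le\gamma(I)$. If $\gamma$ has finite first moment, there is at most one connected part of $\gamma$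 with a given mass and given first moment (the first moment of a measure $\rho$ being $\int y\,\rho(dy)$). Existence of the connected parts appearing in (ii) is part of condition (ii). *)

(* Defs.v *)
From HB Require Import structures.
From mathcomp Require Export all_boot all_order all_algebra.
From mathcomp Require Export all_classical all_reals all_analysis.

Set Implicit Arguments.
Unset Strict Implicit.
Unset Printing Implicit Defensive.

Import Order.TTheory GRing.Theory Num.Theory.
Import numFieldNormedType.Exports.

Local Open Scope classical_set_scope.
Local Open Scope ring_scope.
Local Open Scope ereal_scope.

(* A measure on the Borel sets of an interval I (resp. of I^2) is encoded as a
   Borel measure on R (resp. on R * R) that vanishes outside I (resp. I `*` I).
   Two measures are identified when they agree on all measurable sets: the
   values of a {measure set T -> \bar R} on other sets are irrelevant. *)
Definition measure_on {d} {T : measurableType d} {R : realType} (D : set T)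
    (mu : {measure set T -> \bar R}) : Prop :=
  mu (~` D) = 0.

Definition finite_mean {R : realType} (mu : {measure set R -> \bar R}) : Prop :=
  mu.-integrable [set: R] (fun x => x%:E).

(* Topological support, relative to the ambient space I. *)
Definition supp {R : realType} (I : set R) (mu : {measure set R -> \bar R}) :
    set R :=
  [set x | I x /\ forall U : set R, open U -> U x -> 0 < mu (U `&` I)].

(* The integrals are [\bar R]-valued. For psi convex on the open interval I and
   a probability of finite mean on I, the negative part of psi is integrable
   (psi has an affine minorant), so they are well defined, possibly +oo. *)
Definition convex_order {R : realType} (I : set R)
    (l1 l2 : {measure set R -> \bar R}) : Prop :=
  forall psi : R -> R, convex_function I psi ->
    \int[l1]_(x in I) (psi x)%:E <= \int[l2]_(x in I) (psi x)%:E.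

(* [Y] is a version of the conditional expectation of [X] given the
   sub-sigma-algebra [G]. *)
Definition is_cond_exp {d} {T : measurableType d} {R : realType}
    (P : {measure set T -> \bar R}) (G : set_system T) (X Y : T -> R) : Prop :=
  [/\ P.-integrable [set: T] (EFin \o X),
      P.-integrable [set: T] (EFin \o Y),
      forall B : set R, measurable B -> G (Y @^-1` B) &
      forall A : set T, G A ->
        \int[P]_(w in A) (Y w)%:E = \int[P]_(w in A) (X w)%:E].

Definition sigma_of {d d'} {T : measurableType d} {U : measurableType d'}
    (Z : T -> U) : set_system T :=
  preimage_set_system [set: T] Z measurable.

Definition martingale_coupling {R : realType} (I : set R)
    (l1 l2 : {measure set R -> \bar R})
    (nu : {measure set (R * R) -> \bar R}) : Prop :=
  [/\ measure_on (I `*` I) nu,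
      nu [set: R * R] = 1,
      forall B : set R, measurable B -> pushforward nu fst B = l1 B,
      forall B : set R, measurable B -> pushforward nu snd B = l2 B &
      exists2 Y : R * R -> R,
        is_cond_exp nu (sigma_of (fst : R * R -> R)) snd Y &
        {ae nu, forall w, Y w = w.1}].

Definition curtain_martingale_coupling {R : realType} (I : set R)
    (l1 l2 : {measure set R -> \bar R})
    (nu : {measure set (R * R) -> \bar R}) : Prop :=
  martingale_coupling I l1 l2 nu /\
  exists Gamma : set (R * R),
    [/\ measurable Gamma, Gamma `<=` I `*` I, nu Gamma = 1 &
        forall x y y1 y2 x' y' y1' y2' : R,
          [set (x, y); (x, y1); (x, y2); (x', y'); (x', y1'); (x', y2')]
            `<=` Gamma ->
          ~ [/\ x != x', (y1 < y' < y2)%R & (y1' < y < y2')%R]].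

(* [rho] is the restriction of [gamma] between the quantiles [a] and [b]. *)
Definition is_quantile_restriction {R : realType} (I : set R)
    (gamma : {finite_measure set R -> \bar R}) (a b : R)
    (rho : {measure set R -> \bar R}) : Prop :=
  measure_on I rho /\
  forall x : R, I x ->
    rho (`]-oo, x] `&` I) =
    mine (maxe (gamma (`]-oo, x] `&` I) - a%:E) 0) (b - a)%:E.

Definition is_connected_part {R : realType} (I : set R)
    (gamma : {finite_measure set R -> \bar R})
    (rho : {measure set R -> \bar R}) : Prop :=
  exists a b : R, [/\ (0 <= a)%R, (a <= b)%R, b%:E <= gamma I &
    is_quantile_restriction I gamma a b rho].

Definition is_connected_part_with {R : realType} (I : set R)
    (gamma : {finite_measure set R -> \bar R}) (m c : \bar R)
    (rho : {measure set R -> \bar R}) : Prop :=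
  [/\ is_connected_part I gamma rho, rho I = m & \int[rho]_(y in I) y%:E = c].

Definition is_unique_connected_part_with {R : realType} (I : set R)
    (gamma : {finite_measure set R -> \bar R}) (m c : \bar R)
    (rho : {measure set R -> \bar R}) : Prop :=
  is_connected_part_with I gamma m c rho /\
  forall rho' : {measure set R -> \bar R},
    is_connected_part_with I gamma m c rho' ->
    forall B : set R, measurable B -> rho' B = rho B.

(* [nu] is built from the enumeration [J] (indexed from 0): [gamma] is what is
   left of [l2] after the components before [i] have been removed. *)
Definition sequential_decomposition {R : realType} (I : set R)
    (l1 l2 : {measure set R -> \bar R}) (n : nat) (J : 'I_n -> R)
    (nu : {measure set (R * R) -> \bar R}) : Prop :=
  exists nu_ : 'I_n -> {finite_measure set R -> \bar R},
    (forall B : set (R * R), measurable B ->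
       nu B = \sum_(i < n) (\d_(J i) \x nu_ i) B) /\
    (forall i : 'I_n, exists gamma : {finite_measure set R -> \bar R},
       (forall B : set R, measurable B ->
          gamma B = l2 B - \sum_(j < n | (j < i)%N) nu_ j B) /\
       is_unique_connected_part_with I gamma
         (l1 [set J i]) (l1 [set J i] * (J i)%:E) (nu_ i)).

(* Main.v *)
(* Everything is pulled back to Lebesgue measure through the quantile function
   [q] of [gamma]: [gamma] is the image of Lebesgue measure on [0, gamma(I)]
   under [q], and the connected part between the levels [a] and [b] is the image
   of its restriction to [a, b].

   A connected part leaves no mass of [gamma] strictly inside its convex hull, so
   removing these interiors from the hulls of later parts yields the set [Gamma]
   of a curtain coupling. Conversely, for a curtain coupling, "the fibre over
   [x'] has a point strictly between two points of the fibre over [x]" is a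
   strict partial order on the atoms; along a linear extension of it no later
   fibre meets the interior of the hull of an earlier one, which makes each slice
   a connected part of what is left.

   For existence, convex order is used through the functions [(y - t)^+] only:
   they give a connected part with the prescribed mean by the intermediate value
   theorem, and the domination they express is inherited by what is left after
   removing that part. *)
From HB Require Import structures.
From mathcomp Require Import measurable_realfun lra.
Require Import Defs.
Import Order.TTheory GRing.Theory Num.Theory.
Import numFieldNormedType.Exports.

Local Open Scope classical_set_scope.
Local Open Scope ring_scope.
Local Open Scope ereal_scope.

Set Implicit Arguments.
Unset Strict Implicit.
Unset Printing Implicit Defensive.

(** The obstacle is the atoms of [l2]: a connected part may take only a fraction of an atom at
    either end of its hull. On the side of levels an atom is an interval where the quantile function
    is constant, so splitting it is just cutting an interval, and masses, means and remainders need
    no case distinction on atoms. Shared end points are also why a part exhausts only the interior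
    of its hull, which is exactly what the strict inequalities of the curtain condition see. After
    one removal the remainder lives on a set of levels with a gap. It is not followed there: each
    step starts again from the quantile function of the current remainder, and the induction for
    existence carries only total mass, mean and call integrals. Calls fit this scheme because a call
    is affine on either side of its kink, so its integral over a part whose hull does not straddle
    the kink depends on mass and mean alone. *)

Local Notation leb := (@lebesgue_measure _).

(** * Images of measures *)

(** A relation rather than a pushforward term: measures are identified only on measurable sets, and
    the parts met below are often given by hypothesis instead of being constructed. *)
Definition is_image {d d'} {T : measurableType d} {U : measurableType d'}
    {R : realType} (mu : {measure set T -> \bar R}) (D : set T) (q : T -> U)
    (rho : {measure set U -> \bar R}) : Prop :=
  forall B, measurable B -> rho B = mu (D `&` q @^-1` B).

Section finite_copy.
Context {d} {T : measurableType d} {R : realType}.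
Variables (mu : {measure set T -> \bar R}) (fin : mu setT < +oo).

(** The finiteness proof is an argument of the copy so that the instance attached to it can recover
    that proof. *)
Definition finite_copy of mu setT < +oo : set T -> \bar R := mu.

HB.instance Definition _ := Measure.copy (finite_copy fin) mu.
HB.instance Definition _ :=
  Measure_isFinite.Build _ _ _ (finite_copy fin) (lty_fin_num_fun fin).

End finite_copy.

Lemma finite_measure_pack {d} {T : measurableType d} {R : realType}
    (mu : {measure set T -> \bar R}) : mu setT < +oo ->
  exists rho : {finite_measure set T -> \bar R}, forall B, rho B = mu B.
Proof.
move=> fin; pose rho : {finite_measure set T -> \bar R} := finite_copy fin.
by exists rho.
Qed.

Section image.
Context {d d'} {T : measurableType d} {U : measurableType d'} {R : realType}.
Variables (mu : {measure set T -> \bar R}) (D : set T) (q : T -> U).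
Hypotheses (mD : measurable D) (mq : measurable_fun [set: T] q).

Let image0 : {measure set U -> \bar R} :=
  measure_function_pushforward__canonical__measure_function_Measure
    (mrestr mu mD) mq.

Let image0E : is_image mu D q image0.
Proof. by move=> B mB; rewrite /image0 /= /pushforward /mrestr setIC. Qed.

Lemma image_exists : exists rho : {measure set U -> \bar R}, is_image mu D q rho.
Proof. by exists image0. Qed.

Lemma finite_image_exists : mu D < +oo ->
  exists rho : {finite_measure set U -> \bar R}, is_image mu D q rho.
Proof.
move=> Doo.
have [|rho rhoE] := @finite_measure_pack _ _ _ image0.
  by rewrite image0E// preimage_setT setIT.
by exists rho => B mB; exact: (eq_trans (rhoE B) (image0E mB)).
Qed.

Variables (rho : {measure set U -> \bar R}) (rhoE : is_image mu D q rho).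

Let eq_int (f : U -> \bar R) : \int[rho]_x f x = \int[image0]_x f x.
Proof.
by apply: eq_measure_integral => A mA _; rewrite rhoE// image0E.
Qed.

Lemma ge0_integral_image (f : U -> \bar R) :
  measurable_fun [set: U] f -> (forall y, 0 <= f y) ->
  \int[rho]_y f y = \int[mu]_(x in D) f (q x).
Proof.
move=> mf f0; rewrite eq_int.
rewrite (ge0_integral_pushforward mq (mrestr mu mD) measurableT mf)//.
rewrite preimage_setT (@ge0_negligible_integral _ _ _ _ setT (~` D))//.
- rewrite setTD setCK; apply: eq_measure_integral => A mA AD.
  by rewrite /= /mrestr setIidl.
- exact: measurableC.
- exact: measurableT_comp.
- by move=> x _; exact: f0.
- by rewrite /= /mrestr setICl.
Qed.

Lemma integrable_image (f : U -> \bar R) : measurable_fun [set: U] f ->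
  rho.-integrable [set: U] f <-> mu.-integrable D (f \o q).
Proof.
move=> mf; split => /integrableP[_ fi]; apply/integrableP; split => //.
- by apply: measurable_funTS; exact: measurableT_comp.
- move: fi; rewrite ge0_integral_image//; exact: measurableT_comp.
- by rewrite ge0_integral_image//; exact: measurableT_comp.
Qed.

Lemma integral_image (f : U -> \bar R) : measurable_fun [set: U] f ->
  \int[rho]_y f y = \int[mu]_(x in D) f (q x).
Proof.
move=> mf; rewrite integralE [RHS]integralE.
rewrite (ge0_integral_image (measurable_funepos mf)); last first.
  by move=> y; exact: funepos_ge0.
rewrite (ge0_integral_image (measurable_funeneg mf)); last first.
  by move=> y; exact: funeneg_ge0.
by rewrite (funepos_comp f q) (funeneg_comp f q).
Qed.

End image.

Lemma eq_measure_cdf {R : realType} (m1 m2 : {measure set R -> \bar R}) :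
  m1 setT < +oo -> m2 setT < +oo ->
  (forall x : R, m1 `]-oo, x]%classic = m2 `]-oo, x]%classic) ->
  forall B, measurable B -> m1 B = m2 B.
Proof.
move=> fin fin2 H B mB.
(* The minimum keeps the formula valid for [b < a], where the interval is empty. *)
have itvE (m : {measure set R -> \bar R}) (a b : R) : m setT < +oo ->
    m `]a, b]%classic = m `]-oo, b]%classic - m `]-oo, Order.min a b]%classic.
  move=> moo; have -> : `]a, b]%classic = `]-oo, b] `\` `]-oo, Order.min a b].
    apply/seteqP; split => [x|x [] ]/=; rewrite !in_itv/=.
      by move=> /andP[ax xb]; split => //; apply/negP; rewrite le_min leNgt ax.
    by move=> xb /negP; rewrite le_min xb andbT -ltNge => ->.
  rewrite measureD//.
    by rewrite setIidr//; apply: subset_itvl; rewrite bnd_simp ge_min lexx orbT.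
  by apply: le_lt_trans moo; apply: le_measure; rewrite ?inE.
apply: (measure_unique (@ocitv R) (fun n => `](- n%:R)%R, n%:R]%classic)) => //.
- exact: ocitvI.
- by move=> n; exact: is_ocitv.
- apply/seteqP; split => // x _ /=.
  exists (Num.trunc `|x|%R).+1 => //=; rewrite in_itv/=.
  have : (`|x| < (Num.trunc `|x|).+1%:R)%R by exact: truncnS_gt.
  by rewrite ltr_norml => /andP[-> /ltW ->].
- move=> _ [[a b] _ <-] /=.
  by rewrite !itvE// !H.
- move=> k; apply: le_lt_trans fin; apply: le_measure; rewrite ?inE//.
Qed.

(** * Quantile functions *)

Section monotone_bounds.
Context {d} {T : measurableType d} {R : realType}.
Variables (mu : {measure set T -> \bar R}) (F : (set T)^nat) (c : \bar R).
Hypothesis mF : forall n, measurable (F n).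

Lemma measure_bigcup_le : nondecreasing_seq F -> (forall n, mu (F n) <= c) ->
  mu (\bigcup_n F n) <= c.
Proof.
move=> ndF Fc.
have cv := nondecreasing_cvg_mu (mu := mu) mF (bigcupT_measurable F mF) ndF.
rewrite -(cvg_lim _ cv)//; apply: lime_le; last by apply: nearW => n; exact: Fc.
by apply/cvg_ex; exists (mu (\bigcup_n F n)).
Qed.

Lemma measure_bigcap_ge : nonincreasing_seq F -> mu (F 0%N) < +oo ->
  (forall n, c <= mu (F n)) -> c <= mu (\bigcap_n F n).
Proof.
move=> niF F0 Fc.
have cv := nonincreasing_cvg_mu (mu := mu) F0 mF (bigcapT_measurable mF) niF.
rewrite -(cvg_lim _ cv)//; apply: lime_ge; last by apply: nearW => n; exact: Fc.
by apply/cvg_ex; exists (mu (\bigcap_n F n)).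
Qed.

End monotone_bounds.

Definition mass {R : realType} (gamma : {measure set R -> \bar R}) : R :=
  fine (gamma setT).

Definition dfun {R : realType} (gamma : {measure set R -> \bar R}) (x : R) : R :=
  fine (gamma `]-oo, x]%classic).

(* Outside of the open interval from [0] to the total mass the value [0] is
   arbitrary. *)
Definition quantile {R : realType} (gamma : {measure set R -> \bar R}) (u : R) : R :=
  if (0 < u < mass gamma)%R then inf [set x | (u <= dfun gamma x)%R] else 0%R.

Section quantile.
Context {R : realType}.
Variable gamma : {measure set R -> \bar R}.
Hypothesis fin : gamma setT < +oo.

Local Notation M := (mass gamma).
Local Notation G := (dfun gamma).
Local Notation q := (quantile gamma).

Lemma massE : gamma setT = M%:E.
Proof. by rewrite fineK// ge0_fin_numE. Qed.

Lemma dfunE x : gamma `]-oo, x]%classic = (G x)%:E.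
Proof. by rewrite fineK//; exact: lty_fin_num_fun. Qed.

Lemma dfun_ge0 x : (0 <= G x)%R. Proof. by rewrite -lee_fin -dfunE. Qed.

Lemma dfun_nd x y : (x <= y)%R -> (G x <= G y)%R.
Proof.
move=> xy; rewrite -lee_fin -!dfunE; apply: le_measure; rewrite ?inE//.
exact: subset_itvl.
Qed.

Lemma dfun_le_mass x : (G x <= M)%R.
Proof. by rewrite -lee_fin -dfunE -massE; apply: le_measure; rewrite ?inE. Qed.

Lemma dfun_lt (u : R) : (0 < u)%R -> exists x, (G x < u)%R.
Proof.
move=> u0; apply: contrapT => /forallNP H.
suff : (u%:E <= gamma set0) by rewrite measure0 lee_fin leNgt u0.
have <- : \bigcap_n `]-oo, (- n%:R)%R]%classic = set0 :> set R.
  apply/seteqP; split => // x H1.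
  have := H1 (Num.trunc `|x|%R).+1 I; rewrite /= in_itv/=.
  have : (`|x| < (Num.trunc `|x|).+1%:R)%R by exact: truncnS_gt.
  by rewrite ltr_norml => /andP[xn _]; rewrite leNgt xn.
apply: measure_bigcap_ge => //.
- move=> m n mn; apply/subsetPset; apply: subset_itvl.
  by rewrite bnd_simp lerN2 ler_nat.
- by rewrite dfunE ltry.
- by move=> n; rewrite dfunE lee_fin leNgt; apply/negP/H.
Qed.

Lemma dfun_gt (u : R) : (u < M)%R -> exists x, (u < G x)%R.
Proof.
move=> uM; apply: contrapT => /forallNP H.
suff : (gamma setT <= u%:E) by rewrite massE lee_fin leNgt uM.
have <- : \bigcup_n `]-oo, n%:R]%classic = setT :> set R.
  apply/seteqP; split => // x _; exists (Num.trunc `|x|%R).+1 => //=.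
  have : (`|x| < (Num.trunc `|x|).+1%:R)%R by exact: truncnS_gt.
  by rewrite in_itv/= ltr_norml => /andP[_ /ltW].
apply: measure_bigcup_le => //.
- move=> m n mn; apply/subsetPset; apply: subset_itvl.
  by rewrite bnd_simp ler_nat.
- by move=> n; rewrite dfunE lee_fin leNgt; apply/negP/H.
Qed.

(** Right continuity of the distribution function, in the form that makes the infimum in [quantile]
    attained. *)
Lemma dfun_right u x : (forall y, (x < y)%R -> (u <= G y)%R) -> (u <= G x)%R.
Proof.
move=> H; rewrite -lee_fin -dfunE.
have <- : \bigcap_n `]-oo, (x + n.+1%:R^-1)%R]%classic = `]-oo, x]%classic.
  apply/seteqP; split => [y H1|y /=]; last first.
    by rewrite in_itv/= => yx n _ /=; rewrite in_itv/= ler_wpDr.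
  rewrite /= in_itv/=; apply/ler_addgt0Pr => e e0.
  have := H1 (Num.trunc e^-1) I; rewrite /= in_itv/= => /le_trans; apply.
  rewrite lerD2l invf_ple ?posrE//; exact/ltW/truncnS_gt.
apply: measure_bigcap_ge => //.
- move=> m n mn; apply/subsetPset; apply: subset_itvl.
  by rewrite bnd_simp lerD2l lef_pV2 ?posrE// ler_nat.
- by rewrite dfunE ltry.
- by move=> n; rewrite dfunE lee_fin H// ltrDl.
Qed.

(** The Galois connection between quantile and distribution function; monotonicity of the quantile
    and the computation of its image measures both come from it. *)
Lemma quantile_le u x : (0 < u < M)%R -> (q u <= x)%R = (u <= G x)%R.
Proof.
move=> uM; rewrite /quantile uM; case/andP: uM => u0 uM.
have [x0 Gx0] := dfun_lt u0; have [x1 Gx1] := dfun_gt uM.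
have lb : has_lbound [set x | (u <= G x)%R].
  exists x0 => y /= uy; rewrite leNgt; apply/negP => /ltW/dfun_nd yx.
  by move: (le_trans uy yx); rewrite leNgt Gx0.
apply/idP/idP => [qx|ux]; last exact: ge_inf.
apply: dfun_right => y xy.
have [||z uz zy] := @inf_adherent R [set x | (u <= G x)%R] (y - x).
- by rewrite subr_gt0.
- by split; [exists x1 => /=; exact: ltW|exact: lb].
- apply: le_trans uz _; apply: dfun_nd.
  by apply: le_trans (ltW zy) _; lra.
Qed.

Lemma quantile_nd u v : (0 < u)%R -> (u <= v)%R -> (v < M)%R -> (q u <= q v)%R.
Proof.
move=> u0 uv vM.
have u1 : (0 < u < M)%R by rewrite u0 (le_lt_trans uv).
have v1 : (0 < v < M)%R by rewrite vM (lt_le_trans u0).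
by rewrite quantile_le// (le_trans uv)// -quantile_le.
Qed.

Lemma measurable_quantile : measurable_fun [set: R] q.
Proof.
apply: (measurability (@RGenCInfty.G R)) => [|_ [_ [x ->] <-]].
  exact: RGenCInfty.measurableE.
rewrite setTI; set P := q @^-1` _.
(* On the levels in []0, M[] monotonicity makes the preimage an interval; elsewhere the quantile is
   the constant [0], so the preimage is everything or nothing according to the sign of [x]. *)
rewrite (_ : P = (`]0%R, M[ `&` P) `|` (~` `]0%R, M[ `&` P)); last first.
  by rewrite -setIUl setUv setTI.
apply: measurableU.
  apply: is_interval_measurable => u v []; rewrite /P /= !in_itv/= !andbT.
  move=> /andP[u0 uM] xu [/andP[v0 vM] xv] w /andP[uw wv].
  split; first by rewrite /= in_itv/= (lt_le_trans u0 uw) (le_lt_trans wv vM).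
  rewrite /P/= in_itv/= andbT; apply: le_trans xu _.
  by apply: quantile_nd => //; exact: le_lt_trans vM.
have [x0|x0] := leP x 0%R.
  rewrite (_ : _ `&` _ = ~` `]0%R, M[); first exact: measurableC.
  apply/seteqP; split => [u []//|u /= uM]; split => //.
  by rewrite /P/= /quantile; move: uM; rewrite in_itv/= => /negP/negbTE ->; rewrite in_itv/= x0.
rewrite (_ : _ `&` _ = set0)//; apply/seteqP; split => // u [/= uM].
rewrite /P/= /quantile; move: uM; rewrite in_itv/= => /negP/negbTE ->.
by rewrite in_itv/= leNgt x0.
Qed.


End quantile.

(** * Images of Lebesgue measure under quantile functions *)

Section quantile_image.
Context {R : realType}.
Variable gamma : {measure set R -> \bar R}.
Hypothesis fin : gamma setT < +oo.

Local Notation M := (mass gamma).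
Local Notation G := (dfun gamma).
Local Notation q := (quantile gamma).

Lemma lebesgue_itvoo (a b : R) : (a <= b)%R -> leb `]a, b[%classic = (b - a)%:E.
Proof.
by rewrite [LHS]lebesgue_measure_itv/= lte_fin -EFinB le_eqVlt => /predU1P[->|->//];
  rewrite ltxx subrr.
Qed.

(** For [s = 0] the right-hand side is the clipped distribution function that defines a connected
    part. The shift serves uniqueness, where two windows of equal length are moved to one interval
    of levels. *)
Lemma lebesgue_shift_quantile_le (s a b x : R) :
  (0 <= s + a)%R -> (a <= b)%R -> (s + b <= M)%R ->
  leb (`]a, b[ `&` (fun u => q (s + u)%R) @^-1` `]-oo, x]) =
  (Num.min (Num.max (G x - s - a) 0) (b - a))%:E.
Proof.
move=> a0 ab bM.
have qle u : (a < u)%R -> (u < b)%R -> (q (s + u) <= x)%R = (u <= G x - s)%R.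
  move=> au ub; rewrite quantile_le//; first by rewrite lerBrDl.
  by apply/andP; split; lra.
(* The preimage is an initial segment of the window, closed on the right exactly when the level
   [G x - s] falls short of [b]. *)
have -> : `]a, b[ `&` (fun u => q (s + u)%R) @^-1` `]-oo, x] =
    [set` if (G x - s < b)%R then `]a, (G x - s)%R] else `]a, b[].
  apply/seteqP; split => u.
    move=> [/=]; rewrite !in_itv/= => /andP[au ub]; rewrite qle//.
    by case: ifPn => _ uG; rewrite /= ?in_itv/= ?au.
  move=> H; have [au ub uG] : [/\ (a < u)%R, (u < b)%R & (u <= G x - s)%R].
    move: H => /=; case: ifPn => Gb; rewrite in_itv/= => /andP[-> uG].
      by rewrite uG (le_lt_trans uG Gb).
    by rewrite uG; split => //; rewrite (le_trans (ltW uG))// leNgt.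
  by split; rewrite /= in_itv/= ?au// qle.
case: ifPn => Gb.
  rewrite [LHS]lebesgue_measure_itv/= lte_fin -EFinB.
  rewrite -[LHS](fun_if EFin (a < G x - s)%R (G x - s - a)%R 0%R).
  congr (_%:E); have [?|?] := leP (G x - s - a)%R 0%R.
    by have [?|?] := leP 0%R (b - a)%R; case: ltP => ?; lra.
  by have [?|?] := leP (G x - s - a)%R (b - a)%R; case: ltP => ?; lra.
rewrite lebesgue_itvoo//; congr (_%:E); have [?|?] := leP (G x - s - a)%R 0%R.
  by have [?|?] := leP 0%R (b - a)%R; lra.
by have [?|?] := leP (G x - s - a)%R (b - a)%R; lra.
Qed.

Lemma lebesgue_quantile_le (a b x : R) : (0 <= a)%R -> (a <= b)%R -> (b <= M)%R ->
  leb (`]a, b[ `&` q @^-1` `]-oo, x]) =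
  (Num.min (Num.max (G x - a) 0) (b - a))%:E.
Proof.
move=> a0 ab bM; have := @lebesgue_shift_quantile_le 0%R a b x.
rewrite !add0r subr0 (_ : (fun u => q (0 + u)%R) = q); last first.
  by apply/funext => u; rewrite add0r.
exact.
Qed.

Lemma image_quantile_setT (a b : R) (rho : {measure set R -> \bar R}) :
  (a <= b)%R -> is_image leb `]a, b[ q rho -> rho setT = (b - a)%:E.
Proof.
by move=> ab ->//; rewrite preimage_setT setIT; exact: lebesgue_itvoo.
Qed.

Lemma clip_image (a b : R) (rho : {measure set R -> \bar R}) :
  (0 <= a)%R -> (a <= b)%R -> (b <= M)%R ->
  rho setT < +oo ->
  (forall x, rho `]-oo, x]%classic = (Num.min (Num.max (G x - a) 0) (b - a))%:E) ->
  is_image leb `]a, b[ q rho.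
Proof.
move=> a0 ab bM rhooo rhoE.
have [rho' rho'E] := @image_exists _ _ _ _ _ leb `]a, b[%classic q
  (measurable_itv _) (@measurable_quantile _ _ fin).
move=> B mB; rewrite -rho'E//; apply: eq_measure_cdf => //.
- by rewrite (@image_quantile_setT a b)// ltry.
- by move=> x; rewrite rhoE rho'E//= lebesgue_quantile_le.
Qed.

Lemma quantile_image : is_image leb `]0%R, M[ q gamma.
Proof.
apply: clip_image => //; first by rewrite -lee_fin -massE.
move=> x; rewrite dfunE// !subr0; congr (_%:E).
by rewrite max_l ?dfun_ge0// min_l// dfun_le_mass.
Qed.

Lemma image_quantile_le (D : set R) (rho : {measure set R -> \bar R}) :
  measurable D -> D `<=` `]0%R, M[ -> is_image leb D q rho ->
  forall B, measurable B -> rho B <= gamma B.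
Proof.
move=> mD DM rhoE B mB; rewrite rhoE// quantile_image//.
have mqB : measurable (q @^-1` B).
  by rewrite -[X in measurable X]setTI; exact: measurable_quantile.
by apply: le_measure; rewrite ?inE; [exact: measurableI..|exact: setSI].
Qed.

End quantile_image.

Lemma measure_on_setI {R : realType} (I A : set R) (mu : {measure set R -> \bar R}) :
  measurable I -> measurable A -> measure_on I mu -> mu (A `&` I) = mu A.
Proof.
move=> mI mA muI; rewrite (measureDI mu mA mI).
rewrite [X in X + _](_ : _ = 0) ?add0e//.
apply/eqP; rewrite -measure_le0 -muI; apply: le_measure; rewrite ?inE.
- exact: measurableD.
- exact: measurableC.
- by move=> x [].
Qed.

(** A running maximum over an enumeration of the rationals of [I], so that bounded and unbounded
    right ends are treated alike. It exhausts [I] by segments []-oo, z n]] with [z n] in [I], the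
    only ones a quantile restriction speaks of. *)
Lemma interval_cofinal {R : realType} (I : set R) :
  is_interval I -> open I -> I !=set0 ->
  exists z : nat -> R, [/\ nondecreasing_seq z, forall n, I (z n) &
    forall y, I y -> exists n, (y <= z n)%R].
Proof.
move=> itvI oI [y0 Iy0].
pose next n (x : R) : R := if @unpickle rat n is Some r then
  if `[< I (ratr r) >] then Num.max x (ratr r) else x else x.
pose z := fix z (n : nat) : R := if n is n'.+1 then next n' (z n') else y0.
have nextge n x : (x <= next n x)%R.
  by rewrite /next; case: unpickle => // r; case: ifP => // _; rewrite le_max lexx.
exists z; split.
- by apply/nondecreasing_seqP => n; exact: nextge.
- elim => //= n IH; rewrite /next; case: unpickle => // r.
  by case: asboolP => // Ir; rewrite maxEle; case: ifP.
- move=> y Iy.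
  have /nbhs_ballP[e /= e0 He] : nbhs y I by exact: open_nbhs_nbhs.
  have /rat_in_itvoo[r] : (y < y + e)%R by rewrite ltrDl.
  rewrite inE/= => /andP[]; rewrite !bnd_simp => yr re.
  have Ir : I (ratr r).
    by apply: He; rewrite /ball/= ltr_norml; apply/andP; split; lra.
  exists (pickle r).+1; rewrite /= /next pickleK.
  by case: asboolP => // _; rewrite le_max (ltW yr) orbT.
Qed.

(** * Connected parts *)

Section quantile_restriction.
Context {R : realType}.
Variables (I : set R).
Hypotheses (itvI : is_interval I) (oI : open I) (I0 : I !=set0).
Variable gamma : {finite_measure set R -> \bar R}.
Hypothesis gammaI : measure_on I gamma.

Let mI : measurable I. Proof. exact: is_interval_measurable. Qed.

Let fin : gamma setT < +oo.
Proof. by rewrite -ge0_fin_numE ?measure_ge0// fin_num_measure. Qed.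

Lemma quantile_restriction_total (a b : R) (rho : {measure set R -> \bar R}) :
  (0 <= a)%R -> (a <= b)%R -> b%:E <= gamma I ->
  is_quantile_restriction I gamma a b rho -> rho I = (b - a)%:E.
Proof.
move=> a0 ab bI [rhoI rhoE].
have [z [ndz Iz cz]] := interval_cofinal itvI oI I0.
pose F n := `]-oo, z n] `&` I.
have mF n : measurable (F n) by exact: measurableI.
have ndF : nondecreasing_seq F.
  move=> m n mn; apply/subsetPset; apply: setSI; apply: subset_itvl.
  by rewrite bnd_simp; exact: ndz.
have UF : \bigcup_n F n = I.
  apply/seteqP; split => [y [n _ []]//|y Iy]; have [n yn] := cz _ Iy.
  by exists n => //; split => //=; rewrite in_itv.
have rho_le : rho I <= (b - a)%:E.
  rewrite -[in leLHS]UF; apply: measure_bigcup_le => // n.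
  by rewrite /F rhoE//; rewrite ge_min lexx orbT.
apply/eqP; rewrite eq_le rho_le /=.
(* If the mass falls short of [b - a], the minimum in the definition is never its second argument,
   so [gamma] gives every initial segment at most [rho I + a]; in the limit [gamma I] would be below
   [b]. *)
rewrite leNgt; apply/negP => lt_rho.
have rfin : rho I \is a fin_num.
  by rewrite ge0_fin_numE// (le_lt_trans rho_le)// ltry.
have : gamma I <= rho I + a%:E.
  rewrite -[in leLHS]UF; apply: measure_bigcup_le => // n.
  have : rho (F n) <= rho I by apply: le_measure; rewrite ?inE// => y [].
  rewrite /F rhoE//= ge_min (leNgt (b - a)%:E) lt_rho orbF ge_max => /andP[+ _].
  by rewrite EFinN leeBlDr.
apply/negP; rewrite -ltNge (lt_le_trans _ bI)//.
by move: lt_rho; rewrite -{1 2}(fineK rfin) -EFinD !lte_fin ltrBrDr.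
Qed.

Lemma quantile_restriction_image (a b : R) (rho : {measure set R -> \bar R}) :
  (0 <= a)%R -> (a <= b)%R -> b%:E <= gamma I ->
  is_quantile_restriction I gamma a b rho ->
  is_image leb `]a, b[ (quantile gamma) rho.
Proof.
move=> a0 ab bI rhoQ.
have rhoIE := quantile_restriction_total a0 ab bI rhoQ.
have [rhoI] := rhoQ.
pose g : {measure set R -> \bar R} := gamma.
have gI A : measurable A -> g (A `&` I) = g A.
  by move=> mA; apply: measure_on_setI.
have rI A : measurable A -> rho (A `&` I) = rho A.
  by move=> mA; apply: measure_on_setI.
rewrite -[FiniteMeasure.sort gamma]/(Measure.sort g) => rhoE.
apply: clip_image => //.
- by rewrite -lee_fin -massE// -gI// setTI.
- by rewrite -rI// setTI rhoIE ltry.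
move=> x.
have [Ix|nIx] := pselect (I x).
  by rewrite -rI// rhoE// gI// dfunE// EFin_min EFin_max EFinB.
(* At a point outside [I] the definition is silent; as [I] is an interval, [x] then lies above all
   of [I] or below all of it. *)
have [[y Iy yx]|nI] := pselect (exists2 y, I y & (y <= x)%R).
  have Ile w : I w -> (w <= x)%R.
    move=> Iw; rewrite leNgt; apply/negP => xw; apply: nIx.
    by apply: (itvI Iy Iw); rewrite yx ltW.
  have xI : `]-oo, x] `&` I = I.
    by apply: setIidr => w Iw /=; rewrite in_itv/= Ile.
  have MG : (b <= dfun gamma x)%R.
    by rewrite -lee_fin -dfunE// -gI// xI.
  rewrite -rI// xI rhoIE; congr (_%:E); rewrite max_l ?subr_ge0 ?(le_trans ab)//.
  by rewrite min_r// lerD2r.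
have xI : `]-oo, x] `&` I = set0.
  apply/seteqP; split => // w [] /=; rewrite in_itv/= => wx Iw.
  by apply: nI; exists w.
have Gx : dfun gamma x = 0%R.
  by apply/EFin_inj; rewrite -dfunE// -gI// xI measure0.
by rewrite -rI// xI measure0 Gx max_r ?min_l ?subr_ge0// sub0r oppr_le0.
Qed.

Lemma image_quantile_restriction (a b : R) (rho : {measure set R -> \bar R}) :
  (0 <= a)%R -> (a <= b)%R -> b%:E <= gamma I ->
  is_image leb `]a, b[ (quantile gamma) rho ->
  is_quantile_restriction I gamma a b rho.
Proof.
move=> a0 ab bI rhoE.
have bM : (b <= mass gamma)%R.
  rewrite -lee_fin -massE//; apply: le_trans bI _.
  by apply: le_measure; rewrite ?inE.
have rhoI : measure_on I rho.
  apply/eqP; rewrite -measure_le0 -gammaI.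
  apply: (image_quantile_le fin _ _ rhoE) => //; last exact: measurableC.
  by apply: subset_itv; rewrite bnd_simp.
split => // x Ix; rewrite !measure_on_setI// rhoE// dfunE//.
rewrite -EFinB -EFin_max -EFin_min; exact: lebesgue_quantile_le.
Qed.

End quantile_restriction.

Lemma ae_eq_image {d d'} {T : measurableType d} {U : measurableType d'}
    {R : realType} (mu : {measure set T -> \bar R}) (D : set T) (f g : T -> U)
    (rho rho' : {measure set U -> \bar R}) :
  measurable D -> measurable_fun [set: T] f -> measurable_fun [set: T] g ->
  {ae mu, forall x, D x -> f x = g x} ->
  is_image mu D f rho -> is_image mu D g rho' ->
  forall B, measurable B -> rho B = rho' B.
Proof.
move=> mD mf mg fg rhoE rho'E B mB.
have pm (h : T -> U) : measurable_fun [set: T] h -> measurable (h @^-1` B).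
  by move=> mh; rewrite -[X in measurable X]setTI; exact: mh.
have [N [mN N0 fgN]] := fg.
have NE (A : set T) : measurable A -> mu A = mu (A `\` N).
  move=> mA; rewrite (measureDI mu mA mN) [X in _ + X](_ : _ = 0) ?adde0//.
  by apply: subset_measure0 N0 => //; exact: measurableI.
rewrite rhoE// rho'E// (NE _ (measurableI _ _ mD (pm _ mf))).
rewrite [RHS](NE _ (measurableI _ _ mD (pm _ mg))).
congr (mu _); apply/seteqP; split => x [[Dx]] /= + nNx.
- have -> // : f x = g x by apply: contrapT => fgx; apply/nNx/fgN => /(_ Dx).
- have <- // : f x = g x by apply: contrapT => fgx; apply/nNx/fgN => /(_ Dx).
Qed.

(** The difference [g - f] is nonnegative with zero integral; integrability makes the subtraction of
    the integrals legitimate. *)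
Lemma ge0_sub_integral_eq {d} {T : measurableType d} {R : realType}
    (mu : {measure set T -> \bar R}) (D : set T) (f g : T -> R) :
  measurable D -> mu.-integrable D (EFin \o f) -> mu.-integrable D (EFin \o g) ->
  (forall x, D x -> (f x <= g x)%R) ->
  \int[mu]_(x in D) (f x)%:E = \int[mu]_(x in D) (g x)%:E ->
  {ae mu, forall x, D x -> f x = g x}.
Proof.
move=> mD intf intg fg eq_fg.
have : \int[mu]_(x in D) `|(g x)%:E - (f x)%:E| = 0.
  transitivity (\int[mu]_(x in D) ((g x)%:E - (f x)%:E)).
    apply: eq_integral => x /[!inE] Dx; rewrite gee0_abs//.
    by rewrite -EFinB lee_fin subr_ge0 fg.
  rewrite (integralB mD intg intf) -[X in X - _]/(\int[mu]_(x in D) (g x)%:E).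
  rewrite -eq_fg subee//.
  by apply: integrable_fin_num.
have mgf : measurable_fun D (fun x => (g x)%:E - (f x)%:E).
  by apply: emeasurable_funB; [case/integrableP: intg|case/integrableP: intf].
move/(ae_eq_integral_abs mu mD mgf); apply: filterS => x /[swap] Dx /(_ Dx).
by rewrite /cst -EFinB => -[] /eqP; rewrite subr_eq0 => /eqP ->.
Qed.

(** * Uniqueness of a part of given mass and mean *)

Section uniqueness.
Context {R : realType}.
Variable gamma : {measure set R -> \bar R}.
Hypothesis fin : gamma setT < +oo.

Local Notation M := (mass gamma).
Local Notation q := (quantile gamma).

Lemma shift_quantile_image (a b : R) (rho : {measure set R -> \bar R}) :
  (0 <= a)%R -> (a <= b)%R -> (b <= M)%R -> is_image leb `]a, b[ q rho ->
  is_image leb `]0%R, (b - a)%R[ (fun u => q (a + u)%R) rho.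
Proof.
move=> a0 ab bM rhoE.
have mqa : measurable_fun [set: R] (fun u => q (a + u)%R).
  apply: (measurableT_comp (measurable_quantile fin)).
  exact: measurable_funD.
have [rho' rho'E] := @image_exists _ _ _ _ _ leb `]0%R, (b - a)%R[%classic _
  (measurable_itv _) mqa.
move=> B mB; rewrite -rho'E//; apply: eq_measure_cdf => //.
- by rewrite (image_quantile_setT ab rhoE) ltry.
- rewrite rho'E// preimage_setT setIT.
  apply: (@le_lt_trans _ _ (b - a - 0)%:E); last exact: ltry.
  by rewrite -lebesgue_itvoo// subr_ge0.
move=> x; rewrite rhoE// rho'E//=.
rewrite [LHS]lebesgue_quantile_le// [RHS]lebesgue_shift_quantile_le ?subr0 ?addr0 ?subr_ge0//.
by rewrite addrC subrK.
Qed.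

Hypothesis mean : gamma.-integrable [set: R] EFin.

Lemma integrable_quantile : leb.-integrable `]0%R, M[ (EFin \o q).
Proof.
by apply/(integrable_image _ _ (quantile_image fin)) => //; exact: (measurable_quantile fin).
Qed.

(* If [a <= a'] then [q (a + u) <= q (a' + u)], and equality of the integrals
   over [u] forces equality almost everywhere. *)
Lemma quantile_part_unique (a b a' b' : R) (rho rho' : {measure set R -> \bar R}) :
  (0 <= a)%R -> (a <= b)%R -> (b <= M)%R -> (0 <= a')%R -> (a' <= b')%R -> (b' <= M)%R ->
  (b' - a' = b - a)%R ->
  is_image leb `]a, b[ q rho -> is_image leb `]a', b'[ q rho' ->
  \int[rho]_y y%:E = \int[rho']_y y%:E ->
  forall B, measurable B -> rho B = rho' B.
Proof.
wlog aa' : a b a' b' rho rho' / (a <= a')%R.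
  move=> H; have [aa'|/ltW a'a] := leP a a'; first exact: H.
  move=> a0 ab bM a'0 ab' bM' ba rhoE rho'E eqm B mB.
  by apply/esym; apply: (H a' b' a b).
move=> a0 ab bM a'0 ab' bM' ba rhoE rho'E eqm.
have sub c e : (0 <= c)%R -> (e <= M)%R -> `]c, e[ `<=` `]0%R, M[.
  by move=> c0 eM; apply: subset_itv; rewrite bnd_simp.
have int c e (r : {measure set R -> \bar R}) : (0 <= c)%R -> (e <= M)%R ->
    is_image leb `]c, e[ q r -> r.-integrable [set: R] EFin.
  move=> c0 eM rE; apply/(integrable_image _ _ rE) => //.
    exact: (measurable_quantile fin).
  by apply: integrableS integrable_quantile => //; exact: sub.
have rhoS := shift_quantile_image a0 ab bM rhoE.
have rho'S := shift_quantile_image a'0 ab' bM' rho'E; rewrite ba in rho'S.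
have mq c : measurable_fun [set: measurableTypeR R] (fun u => q (c + u)%R).
  apply: (measurableT_comp (measurable_quantile fin)).
  exact: measurable_funD.
have mD : measurable (`]0%R, (b - a)%R[%classic : set (measurableTypeR R)).
  exact: measurable_itv.
apply: (ae_eq_image mD (mq a) (mq a') _ rhoS rho'S).
apply: ge0_sub_integral_eq => //.
- by apply/(integrable_image mD (mq a) rhoS) => //; exact: int rhoE.
- by apply/(integrable_image mD (mq a') rho'S) => //; exact: int rho'E.
- move=> u; rewrite /= in_itv/= => /andP[u0 ub].
  by apply: quantile_nd => //; lra.
- by rewrite -(integral_image mD (mq a) rhoS)// -(integral_image mD (mq a') rho'S).
Qed.

End uniqueness.

(** * Existence of connected parts with a prescribed mean *)

Definition itv_int {R : realType} (h : R -> R) (a b : R) : R :=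
  (\int[leb]_(u in `]a, b[%classic) h u)%R.

Section interval_integrals.
Context {R : realType}.
Implicit Types (h : R -> R) (a b c M : R).

Lemma integrable_subitv h a b c d : (a <= b)%R -> (c <= d)%R ->
  leb.-integrable `]a, d[ (EFin \o h) -> leb.-integrable `]b, c[ (EFin \o h).
Proof.
move=> ab cd; apply: integrableS => //.
by apply: subset_itv; rewrite bnd_simp.
Qed.

Lemma itv_int_empty h a : itv_int h a a = 0%R.
Proof. by rewrite /itv_int set_itvoo0 Rintegral_set0. Qed.

Lemma itv_int_split h a b c : (a <= b)%R -> (b <= c)%R ->
  leb.-integrable `]a, c[ (EFin \o h) ->
  itv_int h a c = (itv_int h a b + itv_int h b c)%R.
Proof.
move=> ab; rewrite le_eqVlt => /predU1P[<- _|bc ih].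
  by rewrite itv_int_empty addr0.
have iab : leb.-integrable `]a, b[ (EFin \o h).
  by apply: (@integrable_subitv _ a a b c) => //; exact: ltW.
rewrite /itv_int [X in _ = (X + _)%R]Rintegral_itv_bndo_bndc//.
by rewrite -(@Rintegral_itvB _ _ (BRight a) (BLeft c) b)// addrC subrK.
Qed.

Lemma itv_int_cst a b c : (a <= b)%R -> itv_int (fun=> c) a b = (c * (b - a))%R.
Proof.
by move=> ab; rewrite /itv_int Rintegral_cst//= [X in fine X](lebesgue_itvoo ab).
Qed.

Lemma integrable_cst_itv a b c : leb.-integrable `]a, b[ (EFin \o (fun=> c)).
Proof.
apply/integrableP; split; first exact: measurable_cst.
rewrite integral_cst//; have [ab|ba] := leP a b.
  by rewrite [X in _ * X](lebesgue_itvoo ab) ltry.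
by rewrite set_itv_ge ?measure0 ?mule0 ?ltry// bnd_simp -leNgt ltW.
Qed.

End interval_integrals.

Section intermediate_part.
Context {R : realType}.
Variables (q : R -> R) (M : R).
Hypothesis iq : leb.-integrable `]0%R, M[ (EFin \o q).

(** As a function of its left end [a], the integral over a window of length [w] is [F (a + w) - F a]
    for a primitive [F] of [q], hence continuous. *)
Lemma itv_int_window_IVT (w v : R) : (0 <= w <= M)%R ->
  (itv_int q 0%R w <= v <= itv_int q (M - w)%R M)%R ->
  exists2 a : R, (0 <= a <= M - w)%R & itv_int q a (a + w)%R = v.
Proof.
move=> /andP[w0 wM] /andP[lev vle].
(* Extension by zero, so that the primitive is defined and continuous on both sides of [0] and of
   [M]; the bounds [-1] and [M + 1] below make these two points interior. *)
pose h := q \_ `]0%R, M[.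
have ih c d : leb.-integrable `[c, d] (EFin \o h).
  have : leb.-integrable setT (EFin \o h).
    by rewrite -restrict_EFin; apply: (iffLR (integrable_mkcond _ _) iq).
  by apply: integrableS.
have hq c d : (0 <= c)%R -> (d <= M)%R -> itv_int h c d = itv_int q c d.
  move=> c0 dM; apply: eq_Rintegral => u; rewrite inE/= in_itv/= => /andP[cu ud].
  by rewrite /h patchE mem_set//= in_itv/= (le_lt_trans c0 cu) (lt_le_trans ud dM).
pose F (s : R) := parameterized_integral lebesgue_measure (-1)%R s h.
have cF s : (0 <= s <= M)%R -> {for s, continuous F}.
  move=> /andP[s0 sM].
  apply: (@within_continuous_continuous _ _ _ (-1)%R (M + 1)%R); first lra.
    by apply: parameterized_integral_continuous => //; lra.
  by rewrite in_itv/=; apply/andP; split; lra.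
have FE a : (0 <= a <= M - w)%R -> (F (a + w) - F a)%R = itv_int q a (a + w)%R.
  move=> /andP[a0 aM]; rewrite -hq//; last lra.
  rewrite /itv_int.
  rewrite Rintegral_itv_bndo_bndc//; last first.
    by apply: integrableS (ih a (a + w)%R) => //; apply: subset_itv; rewrite bnd_simp.
  by rewrite -(@Rintegral_itvB _ _ (BLeft (-1)%R) (BRight (a + w)%R) a)//; rewrite bnd_simp; lra.
have wM0 : (0 <= M - w)%R by lra.
have [||a] := @IVT R (fun a => F (a + w) - F a)%R 0%R (M - w)%R v wM0.
- apply: continuous_in_subspaceT => s; rewrite inE/= in_itv/= => /andP[s0 sM].
  apply: (@cvgB _ R^o); last by apply: cF; rewrite s0/=; lra.
  apply: (@continuous_comp _ _ _ (fun s => s + w)%R F).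
    by apply: (@cvgD _ R^o); [exact: cvg_id|exact: cvg_cst].
  by apply: cF; apply/andP; split; lra.
- rewrite !FE ?lexx ?wM0// add0r subrK.
  by rewrite ge_min le_max lev vle orbT.
- by rewrite in_itv/= => aM; rewrite FE// => <-; exists a.
Qed.

End intermediate_part.

(** * Call functions of finitely supported measures *)

Section callsum.
Local Open Scope ring_scope.
Context {R : realType}.
Implicit Types (l : seq (R * R)) (t c d : R).

(** The integral of the call [(y - t)^+] against the measure with masses [p.1] at the points [p.2].
    For nonnegative masses it is convex and nonincreasing in [t], with slopes between [- weight l]
    and [0]. *)
Definition callsum l t : R := \sum_(p <- l) p.1 * Num.max (p.2 - t) 0.
Definition weight l : R := \sum_(p <- l) p.1.
Definition moment l : R := \sum_(p <- l) p.1 * p.2.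

Lemma weight_ge0 l : all (fun p => 0 <= p.1) l -> 0 <= weight l.
Proof. by move=> /allP l0; rewrite /weight big_seq sumr_ge0. Qed.

Lemma callsum_cons w x l t : callsum ((w, x) :: l) t = w * Num.max (x - t) 0 + callsum l t.
Proof. by rewrite /callsum big_cons. Qed.

Lemma callsum_ge0 l t : all (fun p => 0 <= p.1) l -> 0 <= callsum l t.
Proof.
move=> /allP l0; rewrite /callsum big_seq sumr_ge0// => p /l0 p0.
by rewrite mulr_ge0// le_max lexx orbT.
Qed.

Lemma callsum_ge l t : all (fun p => 0 <= p.1) l ->
  moment l - weight l * t <= callsum l t.
Proof.
move=> /allP l0; rewrite mulr_suml -sumrB [leLHS]big_seq [leRHS]big_seq; apply: ler_sum => p /l0 p0.
by rewrite -mulrBr ler_wpM2l// le_max lexx.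
Qed.

Lemma callsum_le l t d : all (fun p => 0 <= p.1) l -> t <= d ->
  callsum l d <= callsum l t.
Proof.
move=> /allP l0 td; rewrite /callsum [leLHS]big_seq [leRHS]big_seq; apply: ler_sum => p /l0 p0.
rewrite ler_wpM2l//.
by have [?|?] := leP (p.2 - d) 0; have [?|?] := leP (p.2 - t) 0; lra.
Qed.

Lemma callsum_lip l t d : all (fun p => 0 <= p.1) l -> t <= d ->
  callsum l t <= callsum l d + weight l * (d - t).
Proof.
move=> /allP l0 td; rewrite mulr_suml -big_split/= /callsum [leLHS]big_seq [leRHS]big_seq.
apply: ler_sum => p /l0 p0; rewrite -mulrDr ler_wpM2l//.
by have [?|?] := leP (p.2 - d) 0; have [?|?] := leP (p.2 - t) 0; lra.
Qed.

(** Convexity cleared of the denominator [d - c]. *)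
Lemma callsum_convex l c t d : all (fun p => 0 <= p.1) l -> c <= t -> t <= d ->
  (d - c) * callsum l t <= (d - t) * callsum l c + (t - c) * callsum l d.
Proof.
move=> /allP l0 ct td; rewrite !mulr_sumr -big_split/= [leLHS]big_seq [leRHS]big_seq.
apply: ler_sum => p /l0 p0; rewrite !(mulrCA _ p.1) -mulrDr ler_wpM2l//.
by have [?|?] := leP (p.2 - d) 0; have [?|?] := leP (p.2 - t) 0;
  have [?|?] := leP (p.2 - c) 0; nra.
Qed.

Lemma weight0_callsum l t : all (fun p => 0 <= p.1) l -> weight l = 0 ->
  callsum l t = 0 /\ moment l = 0.
Proof.
move=> /allP l0 /eqP; rewrite /weight big_seq psumr_eq0// => /allP l1.
split; rewrite /callsum /moment big_seq big1// => p pl;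
by have := l1 _ pl; rewrite pl/= => /eqP ->; rewrite mul0r.
Qed.

End callsum.

(** * Removal of one part from a nondecreasing function of the level *)

Section shadow_step.
Local Open Scope ring_scope.
Context {R : realType}.
Variables (q : R -> R) (M : R).
Hypothesis iq : leb.-integrable `]0%R, M[ (EFin \o q).
Hypothesis ndq : forall u v, 0 < u -> u <= v -> v < M -> q u <= q v.

Let call t u := Num.max (q u - t) 0.

Let iqs a b : 0 <= a -> b <= M -> leb.-integrable `]a, b[ (EFin \o q).
Proof. by move=> a0 bM; apply: integrable_subitv iq. Qed.

Lemma integrable_call_comp t a b : 0 <= a -> b <= M ->
  leb.-integrable `]a, b[ (EFin \o call t).
Proof.
move=> a0 bM; rewrite (_ : EFin \o call t = (fun u => (q u - t)%:E)^\+)%E; last first.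
  by apply/funext => u; rewrite funeposE /= /call EFin_max.
apply: integrable_funepos => //.
rewrite (_ : (fun u => (q u - t)%:E) = ((EFin \o q) \- (EFin \o (fun=> t)))%E)//.
by apply: integrableB => //; [exact: iqs|exact: integrable_cst_itv].
Qed.

Let int_call_above t a b : 0 <= a -> a <= b -> b <= M ->
  (forall u, a < u < b -> t <= q u) -> itv_int (call t) a b = itv_int q a b - t * (b - a).
Proof.
move=> a0 ab bM tq; rewrite -itv_int_cst// -RintegralB//; last 2 first.
  exact: iqs.
  exact: integrable_cst_itv.
rewrite /itv_int; apply: eq_Rintegral => u; rewrite inE/= in_itv/= => /tq tqu.
by rewrite /call max_l// subr_ge0.
Qed.

Let int_call_below t a b : (forall u, a < u < b -> q u <= t) -> itv_int (call t) a b = 0.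
Proof.
move=> qt; rewrite /itv_int (@eq_Rintegral _ _ _ _ _ (fun=> 0)); last first.
  move=> u; rewrite inE/= in_itv/= => /qt qut.
  by rewrite /call max_r// subr_le0.
by rewrite /Rintegral integral0.
Qed.

(** Here [s] is a level at which [q] crosses [t]; the case of interest is [t = q s]. *)
Let int_callE t s : 0 <= s <= M -> (forall u, 0 < u < s -> q u <= t) ->
  (forall u, s < u < M -> t <= q u) ->
  itv_int (call t) 0 M = itv_int q s M - t * (M - s).
Proof.
move=> /andP[s0 sM] qt tq; rewrite (@itv_int_split _ _ _ s)//; last exact: integrable_call_comp.
by rewrite int_call_below// add0r int_call_above.
Qed.

Variables (w x : R) (l : seq (R * R)).
Hypotheses (w0 : 0 <= w) (l0 : all (fun p => 0 <= p.1) l).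
Hypothesis massE : M = w + weight l.
Hypothesis meanE : itv_int q 0 M = w * x + moment l.
Hypothesis order : forall t, w * Num.max (x - t) 0 + callsum l t <= itv_int (call t) 0 M.

Let W0 : 0 <= weight l. Proof. exact: weight_ge0. Qed.

Let int_callq s : 0 < s < M -> itv_int (call (q s)) 0 M = itv_int q s M - q s * (M - s).
Proof.
move=> /andP[s0 sM]; apply: int_callE => [|u /andP[u0 us]|u /andP[su uM]].
- by rewrite !ltW.
- by apply: ndq => //; exact: ltW.
- by apply: ndq => //; exact: ltW.
Qed.

Let wmax t : w * (x - t) <= w * Num.max (x - t) 0.
Proof. by rewrite ler_wpM2l// le_max lexx. Qed.

Let wmax0 t : 0 <= w * Num.max (x - t) 0.
Proof. by rewrite mulr_ge0// le_max lexx orbT. Qed.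

(* The bounds for the intermediate value theorem come from [order] at the
   quantiles [q w] and [q (M - w)]. *)
Lemma part_with_mean : exists2 a : R, 0 <= a <= M - w & itv_int q a (a + w) = w * x.
Proof.
have [w0' massE' meanE' W0'] : [/\ 0 <= w, M = w + weight l,
  itv_int q 0 M = w * x + moment l & 0 <= weight l] by split.
have wM : w <= M by rewrite massE lerDl.
have wM' : 0 <= M - w by rewrite subr_ge0.
apply: itv_int_window_IVT => //; first by rewrite w0.
have qw : itv_int q 0 M = itv_int q 0 w + itv_int q w M by apply: itv_int_split.
have qMw : itv_int q 0 M = itv_int q 0 (M - w) + itv_int q (M - w) M.
  by apply: itv_int_split => //; lra.
(* [order] can be evaluated at the quantile of interior levels only, so [w = M] and [w = 0] are
   settled apart; in both cases only one value of the mean is possible. *)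
have [wM1|wM1] := eqVneq w M.
  have W00 : weight l = 0 by lra.
  have [_ m0] := weight0_callsum 0 l0 W00.
  by move: meanE'; rewrite -wM1 subrr => ->; rewrite m0 addr0 lexx.
have wltM : w < M by rewrite lt_neqAle wM1.
have [w00|w00] := eqVneq w 0.
  by rewrite w00 subr0 !itv_int_empty mul0r lexx.
have wgt0 : 0 < w by rewrite lt_neqAle eq_sym w00.
apply/andP; split.
  (* The atom's call is bounded below by [0], that of the rest by its affine minorant. Since
     [M - w = weight l] the terms in [q w] cancel, leaving [moment l <= itv_int q w M]. *)
  have := order (q w); rewrite int_callq ?wgt0//.
  have -> : M - w = weight l by lra.
  have := callsum_ge (q w) l0; have := wmax0 (q w).
  nra.
(* The roles are exchanged: [0] for the rest and the affine minorant for the atom give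
   [w * x <= itv_int q (M - w) M]. *)
have := order (q (M - w)); rewrite int_callq; last by apply/andP; split; lra.
have -> : M - (M - w) = w by lra.
have := callsum_ge0 (q (M - w)) l0; have := wmax (q (M - w)).
nra.
Qed.

(* If [t] is not inside the hull of the removed part, [call t] is affine on it
   and [order t] suffices. Otherwise the right-hand side is affine in [t] between
   [q a] and [q b] and the convex left-hand side is compared at these points. *)
Lemma shadow_step : exists a : R, [/\ 0 <= a <= M - w, itv_int q a (a + w) = w * x &
  forall t, callsum l t <= itv_int (call t) 0 M - itv_int (call t) a (a + w)].
Proof.
have [w0' massE' meanE' W0'] : [/\ 0 <= w, M = w + weight l,
  itv_int q 0 M = w * x + moment l & 0 <= weight l] by split.
have [a /andP[a0 aM] mean_a] := part_with_mean.
exists a; split => //; first by rewrite a0.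
move=> t; have [b bE] : exists b, b = a + w by exists (a + w).
rewrite -bE in mean_a *; have ab : a <= b by rewrite bE lerDl.
have bM : b <= M by lra.
have [above|/existsNP[u0 /not_implyP[/andP[au0 u0b] /negP]]] :=
  pselect (forall u, a < u < b -> t <= q u).
  rewrite (@int_call_above t a b)// mean_a (_ : b - a = w); last by lra.
  by have := order t; have := wmax t; lra.
rewrite -ltNge => qu0.
have [below|/existsNP[v0 /not_implyP[/andP[av0 v0b] /negP]]] :=
  pselect (forall u, a < u < b -> q u <= t).
  by rewrite (@int_call_below t a b)// subr0; have := order t; have := wmax0 t; lra.
rewrite -ltNge => qv0.
(* As [q] crosses [t] inside the window, the call vanishes at the levels before [a] and equals
   [q - t] at those after [b]; the window itself cancels. *)
have -> : itv_int (call t) 0 M - itv_int (call t) a b = itv_int q b M - t * (M - b).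
  rewrite (@itv_int_split _ _ 0 a M)//; [|lra|exact: integrable_call_comp].
  rewrite (@itv_int_split _ _ a b M)//; last exact: integrable_call_comp.
  rewrite int_call_below; last first.
    move=> u /andP[u0' ua]; apply: le_trans (ltW qu0).
    by apply: ndq => //; lra.
  rewrite [itv_int _ b M]int_call_above//; [by rewrite add0r addrC addKr|lra|].
  move=> u /andP[bu uM]; apply: (le_trans (ltW qv0)).
  by apply: ndq => //; lra.
(* At [q a] the window contributes [w * (x - q a)], which the atom term of [order] absorbs; at [q b]
   it contributes nothing and the atom term is dropped. *)
have left : 0 < a -> callsum l (q a) <= itv_int q b M - q a * (M - b).
  move=> agt0; have := order (q a); rewrite int_callq; last first.
    by rewrite agt0/=; lra.
  rewrite (@itv_int_split _ _ a b M)//; last exact: iqs.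
  by rewrite mean_a; have := wmax (q a); rewrite bE; nra.
have right : b < M -> callsum l (q b) <= itv_int q b M - q b * (M - b).
  move=> bltM; have := order (q b); rewrite int_callq; last first.
    by rewrite bltM; lra.
  by have := wmax0 (q b); lra.
have qat : 0 < a -> q a <= t.
  by move=> agt0; apply: le_trans (ltW qu0); apply: ndq => //; lra.
have qbt : b < M -> t <= q b.
  by move=> bltM; apply: le_trans (ltW qv0) _; apply: ndq => //; lra.
(* For [b = M] there is no comparison point on the right, but the right-hand side is constant in [t]
   and monotonicity of [callsum] carries the bound from [q a] to [t]. If also [a = 0], no weight
   remains. *)
have [bltM|] := ltP b M; last first.
  move=> Mb; have {Mb} bME : b = M by lra.
  rewrite bME in left *; rewrite itv_int_empty subrr mulr0 subr0.
  have [agt0|] := ltP 0 a.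
    apply: (le_trans (callsum_le l0 (qat agt0))); apply: le_trans (left agt0) _.
    by rewrite itv_int_empty; lra.
  move=> a00; have W00 : weight l = 0 by lra.
  by rewrite (weight0_callsum t l0 W00).1.
(* For [a = 0] the right-hand side has slope [- weight l], the steepest possible for [callsum], so
   the bound at [q b] carries over to [t]. *)
have [agt0|a00] := ltP 0 a; last first.
  apply: (le_trans (callsum_lip l0 (qbt bltM))).
  have -> : weight l = M - b by lra.
  by have := right bltM; nra.
have := callsum_convex l0 (qat agt0) (qbt bltM).
have := left agt0; have := right bltM; have := qat agt0; have := qbt bltM.
set d := q b; set c := q a => td ct Hd Hc H.
have [cd|cd] := eqVneq c d.
  have -> : t = d by lra.
  by [].
rewrite -(@ler_pM2l _ (d - c)); last by rewrite subr_gt0 lt_neqAle cd/=; lra.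
apply: (le_trans H); nra.
Qed.

End shadow_step.

Definition call {R : realType} (t y : R) : R := Num.max (y - t)%R 0%R.

Lemma measurable_call {R : realType} (t : R) : measurable_fun [set: R] (call t).
Proof.
apply: measurable_maxr; last exact: measurable_cst.
by apply: measurable_funB => //; exact: measurable_cst.
Qed.

(* [gamma] dominates the discrete measure with weights [p.1] at the points
   [p.2], [p] in [l], in the convex order. *)
Definition dominates_discrete {R : realType} (gamma : {measure set R -> \bar R})
    (l : seq (R * R)) : Prop :=
  [/\ gamma setT = (weight l)%:E,
      gamma.-integrable [set: R] EFin,
      \int[gamma]_y y%:E = (moment l)%:E &
      forall t, (callsum l t)%:E <= \int[gamma]_y (call t y)%:E].

Section shadow_step_measure.
Context {R : realType}.
Variable gamma : {measure set R -> \bar R}.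
Hypothesis fin : gamma setT < +oo.

Local Notation M := (mass gamma).
Local Notation q := (quantile gamma).

Let mq : measurable_fun [set: measurableTypeR R] q := measurable_quantile fin.

Lemma image_itv_int (a b : R) (rho : {measure set R -> \bar R}) (f : R -> R) :
  measurable_fun [set: R] f ->
  is_image leb `]a, b[ q rho -> leb.-integrable `]a, b[ (EFin \o (f \o q)) ->
  \int[rho]_y (f y)%:E = (itv_int (f \o q) a b)%:E.
Proof.
move=> mf rhoE ifq.
rewrite (integral_image _ mq rhoE)//; last exact/measurable_EFinP.
by rewrite /itv_int /Rintegral fineK//; exact: integrable_fin_num.
Qed.

Lemma image_setD (a b : R) (rho g : {measure set R -> \bar R}) (B : set R) :
  (0 <= a)%R -> (a <= b)%R -> (b <= M)%R -> measurable B ->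
  is_image leb `]a, b[ q rho -> is_image leb (`]0%R, M[ `\` `]a, b[) q g ->
  gamma B = rho B + g B.
Proof.
move=> a0 ab bM mB rhoE gE; rewrite rhoE// gE// quantile_image//.
have mqB : measurable (q @^-1` B : set (measurableTypeR R)).
  by rewrite -[X in measurable X]setTI; exact: mq.
have sub : `]a, b[ `<=` `]0%R, M[ by apply: subset_itv; rewrite bnd_simp.
rewrite -measureU//.
- by rewrite -setIUl setDUK.
- exact: measurableI.
- by apply: measurableI => //; exact: measurableD.
- by rewrite setIACA setDIK set0I.
Qed.

Lemma image_setD_itv_int (a b : R) (g : {measure set R -> \bar R}) (f : R -> R) :
  (0 <= a)%R -> (a <= b)%R -> (b <= M)%R ->
  measurable_fun [set: R] f ->
  is_image leb (`]0%R, M[ `\` `]a, b[) q g ->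
  leb.-integrable `]0%R, M[ (EFin \o (f \o q)) ->
  \int[g]_y (f y)%:E = (itv_int (f \o q) 0 M - itv_int (f \o q) a b)%:E.
Proof.
move=> a0 ab bM mf gE ifq.
have sub : `]a, b[ `<=` `]0%R, M[ by apply: subset_itv; rewrite bnd_simp.
rewrite (integral_image _ mq gE)//; last first.
- exact/measurable_EFinP.
- exact: measurableD.
have iD : leb.-integrable (`]0%R, M[ `\` `]a, b[) (EFin \o (f \o q)).
  by apply: integrableS ifq => //; exact: measurableD.
rewrite -[LHS]fineK; last by apply: integrable_fin_num => //; exact: measurableD.
congr (_%:E); apply/eqP; rewrite eq_sym subr_eq addrC; apply/eqP.
rewrite /itv_int -[X in Rintegral _ X](setDUK sub) Rintegral_setU//.
- exact: measurableD.
- by rewrite setDUK.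
- by apply/eqP; rewrite setDIK.
Qed.

(** The remainder [g] is the image of the complement of the window under the same quantile function.
    Only the splitting of [gamma] and the domination are exported, which is all the next step
    requires to start from the quantile function of [g]. *)
Lemma shadow_step_measure (w x : R) (l : seq (R * R)) : (0 <= w)%R ->
  all (fun p => 0 <= p.1)%R l -> dominates_discrete gamma ((w, x) :: l) ->
  exists (a : R) (th g : {finite_measure set R -> \bar R}),
    [/\ (0 <= a)%R, (a + w <= M)%R & is_image leb `]a, (a + w)%R[ q th] /\
    [/\ \int[th]_y y%:E = (w * x)%:E,
        forall B, measurable B -> gamma B = th B + g B &
        dominates_discrete g l].
Proof.
move=> w0 l0 [gammaT ig meang ord].
have iq := integrable_quantile fin ig.
have ME : M = (w + weight l)%R.
  by apply/EFin_inj; rewrite -massE// gammaT /weight big_cons.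
have meanE : itv_int q 0%R M = (w * x + moment l)%R.
  apply/EFin_inj; rewrite -(image_itv_int (@measurable_id _ _ setT) (quantile_image fin) iq).
  by rewrite meang /moment big_cons.
have icall t : leb.-integrable `]0%R, M[ (EFin \o (call t \o q)).
  exact: (integrable_call_comp iq).
have ord' t : (w * Num.max (x - t) 0 + callsum l t <= itv_int (call t \o q) 0 M)%R.
  rewrite -lee_fin -callsum_cons.
  by rewrite -(image_itv_int (measurable_call t) (quantile_image fin) (icall t)) ord.
have [a [/andP[a0 aM] mean_a Ha]] :=
  @shadow_step _ q M iq (@quantile_nd _ _ fin) w x l w0 l0 ME meanE ord'.
have ab : (a <= a + w)%R by rewrite lerDl.
have bM : (a + w <= M)%R by rewrite -lerBrDr.
have leb_oo (D : set (measurableTypeR R)) : measurable D -> D `<=` `]0%R, M[ -> leb D < +oo.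
  move=> mD DM; apply: (@le_lt_trans _ _ (M - 0)%:E); last exact: ltry.
  rewrite -lebesgue_itvoo//; last by rewrite ME addr_ge0// weight_ge0.
  by apply: (@le_measure _ _ _ lebesgue_measure); rewrite ?inE.
have sub : `]a, (a + w)%R[ `<=` `]0%R, M[ by apply: subset_itv; rewrite bnd_simp.
have mab : measurable (`]a, (a + w)%R[%classic : set (measurableTypeR R)).
  exact: measurable_itv.
have [th thE] := finite_image_exists mab mq (leb_oo _ mab sub).
have mD : measurable (`]0%R, M[ `\` `]a, (a + w)%R[ : set (measurableTypeR R)) by exact: measurableD.
have [g gE] := finite_image_exists mD mq (leb_oo _ mD (@subDsetl _ _ _)).
exists a, th, g; split; split => //.
- rewrite (image_itv_int (@measurable_id _ _ setT) thE) ?mean_a//.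
  exact: (integrableS _ mab sub iq).
- by move=> B mB; exact: image_setD thE gE.
- split.
  + have := image_setD a0 ab bM measurableT thE gE.
    rewrite (image_quantile_setT ab thE) gammaT /weight big_cons/=.
    rewrite (_ : a + w - a = w)%R; last by rewrite addrAC subrr add0r.
    by move=> /(congr1 (fun z => z - w%:E)); rewrite EFinD addeAC subee// add0e addeAC subee// add0e.
  + apply/(integrable_image mD mq gE) => //.
    by apply: integrableS iq => //; exact: subDsetl.
  + apply: etrans (image_setD_itv_int a0 ab bM (@measurable_id _ _ setT) gE iq) _.
    congr (_%:E); rewrite -[LHS]/(itv_int q 0%R M - itv_int q a (a + w))%R.
    by rewrite meanE mean_a addrAC subrr add0r.
  + move=> t.
    rewrite (image_setD_itv_int a0 ab bM (measurable_call t) gE (icall t)) lee_fin.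
    exact: Ha.
Qed.

End shadow_step_measure.

(** [g i] is the remainder before step [i]. Sequences over [nat] and a list of atoms keep the
    recursion free of casts between ordinals; entries past [size l] are arbitrary. *)
Lemma shadow_chain {R : realType} (l : seq (R * R))
    (gamma : {finite_measure set R -> \bar R}) :
  all (fun p => 0 <= p.1)%R l -> dominates_discrete gamma l ->
  exists th g : nat -> {finite_measure set R -> \bar R},
    g 0%N = gamma /\ forall i, (i < size l)%N ->
    let p := nth (0, 0)%R l i in
    (exists a : R, [/\ (0 <= a)%R, (a + p.1 <= mass (g i))%R &
      is_image leb `]a, (a + p.1)%R[ (quantile (g i)) (th i)]) /\
    \int[th i]_y y%:E = (p.1 * p.2)%:E /\
    (g i : {measure set R -> \bar R}).-integrable [set: R] EFin /\
    forall B, measurable B -> g i B = th i B + g i.+1 B.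
Proof.
elim: l gamma => [|[w x] l IH] gamma /=; first by exists (fun=> gamma), (fun=> gamma).
move=> /andP[w0 l0] dom.
have fin : gamma setT < +oo by case: dom => -> *; rewrite ltry.
have [a [th0 [g1 [[a0 aM thE] [mean_th gE dom1]]]]] := shadow_step_measure fin w0 l0 dom.
have [th [g [g0 H]]] := IH g1 l0 dom1.
exists (fun i => if i is j.+1 then th j else th0).
exists (fun i => if i is j.+1 then g j else gamma); split => // -[_|i il] /=.
  split; first by exists a.
  split => //; split; first by case: dom.
  by move=> B mB; rewrite g0; exact: gE.
exact: H.
Qed.

(** * Finite supports and slices *)

Section finite_carrier.
Context {d} {T : measurableType d} {R : realType} {n : nat}.
Variables (mu : {measure set T -> \bar R}) (F : 'I_n -> set T).
Hypothesis mF : forall i, measurable (F i).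
Hypothesis tF : forall i j, i != j -> F i `&` F j = set0.
Hypothesis muF : mu (~` \bigcup_i F i) = 0.

Let FE : \bigcup_i F i = \big[setU/set0]_(i < n) F i.
Proof.
by rewrite -bigcup_seq; apply: eq_bigcupl; split => i //= _; rewrite mem_index_enum.
Qed.

Let mUF : measurable (\bigcup_i F i).
Proof. by rewrite FE; exact: bigsetU_measurable. Qed.

Let trivI (D : set T) (P : set 'I_n) : trivIset P (fun i => D `&` F i).
Proof.
by apply/trivIsetP => i j _ _ ij; rewrite setIACA tF// setI0.
Qed.

Lemma measure_finite_carrier A : measurable A ->
  mu A = \sum_(i < n) mu (A `&` F i).
Proof.
move=> mA; rewrite (measureDI mu mA mUF) [X in X + _](_ : _ = 0) ?add0e; last first.
  apply: subset_measure0 muF; [exact: measurableD|exact: measurableC|].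
  by move=> x [].
rewrite FE big_distrr/= measure_bigsetU_ord//.
by move=> i; exact: measurableI.
Qed.

Lemma integral_finite_carrier D (f : T -> R) : measurable D ->
  mu.-integrable D (EFin \o f) ->
  \int[mu]_(x in D) (f x)%:E = \sum_(i < n) \int[mu]_(x in D `&` F i) (f x)%:E.
Proof.
move=> mD intf.
rewrite (negligible_integral (measurableC mUF) mD intf muF) setDE setCK FE.
rewrite big_distrr/= integral_bigsetU_EFin//.
- by move=> i; exact: measurableI.
- exact: index_enum_uniq.
- case/integrableP: intf => + _; apply: measurable_funS => //.
  by rewrite -big_distrr/=; exact: subIsetl.
Qed.

End finite_carrier.

Lemma finite_set_closed {R : realType} (A : set R) : finite_set A -> closed A.
Proof.
apply: (iffLR (@accessible_finite_set_closed R)).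
exact/hausdorff_accessible/norm_hausdorff.
Qed.

Section finite_support.
Context {R : realType} (I : set R) (mu : {measure set R -> \bar R}).
Hypotheses (oI : open I) (muI : measure_on I mu).

Let mI : measurable I. Proof. exact: open_measurable. Qed.

(** Second countability: a point of [I] outside the support lies in a null interval with rational
    ends, and there are countably many of these. Finiteness makes the support measurable. *)
Lemma measure_suppC : finite_set (supp I mu) -> mu (~` supp I mu) = 0.
Proof.
move=> fs.
have ms : measurable (supp I mu) by apply: closed_measurable; exact: finite_set_closed.
(* The null intervals with rational ends, indexed by their codes; all other codes give the empty
   set. *)
pose F k := if @unpickle (rat * rat)%type k is Some pr then
  if `[< mu (`]ratr pr.1, ratr pr.2[ `&` I) = 0 >]
  then `]ratr pr.1, ratr pr.2[%classic `&` I else set0 else set0.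
have mF k : measurable (F k).
  by rewrite /F; case: unpickle => // pr; case: ifP => // _; apply: measurableI.
have F0 k : mu (F k) = 0.
  rewrite /F; case: unpickle => [pr|]; last exact: measure0.
  by case: asboolP => // _; rewrite measure0.
have nUF : mu.-negligible (\bigcup_k F k).
  by apply: negligible_bigcup => k; apply/negligibleP; [exact: mF|exact: F0].
have [N [mN N0 sN]] : mu.-negligible (~` I `|` \bigcup_k F k).
  apply: negligibleU => //.
  by apply/negligibleP; [exact: measurableC|exact: muI].
apply: subset_measure0 N0 => //; first exact: measurableC.
apply: subset_trans sN => x nsx.
have [Ix|] := pselect (I x); last by left.
right; have [U [oU Ux mU0]] : exists U, [/\ open U, U x & mu (U `&` I) = 0].
  apply: contrapT => H; apply: nsx; split => // U oU Ux.
  rewrite lt0e measure_ge0 andbT; apply/eqP => U0; apply: H.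
  by exists U.
have /nbhs_ballP[e /= e0 He] : nbhs x U by exact: open_nbhs_nbhs.
have /rat_in_itvoo[r] : (x < x + e)%R by rewrite ltrDl.
rewrite inE/= => /andP[]; rewrite !bnd_simp => xr re.
have /rat_in_itvoo[p] : (x - e < x)%R by rewrite ltrBlDr ltrDl.
rewrite inE/= => /andP[]; rewrite !bnd_simp => ep px.
exists (pickle (p, r)); first exact: Logic.I.
rewrite /F pickleK.
case: asboolP => [_|[]]; first by split => //=; rewrite in_itv/= px.
apply: subset_measure0 mU0.
- exact: measurableI.
- by apply: measurableI => //; exact: open_measurable.
- apply: setSI => y /=; rewrite in_itv/= => /andP[py yr]; apply: He.
  by rewrite /ball/= ltr_norml; apply/andP; split; lra.
Qed.

(** Removing the finitely many other points of the support leaves an open neighbourhood of [x],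
    whose mass is positive and can only sit at [x]. *)
Lemma supp_atom x : finite_set (supp I mu) -> supp I mu x -> 0 < mu [set x].
Proof.
move=> fs sx; have s0 := measure_suppC fs.
have ms : measurable (supp I mu) by apply: closed_measurable; exact: finite_set_closed.
pose U := ~` (supp I mu `\ x).
have oU : open U.
  by rewrite openC; apply: finite_set_closed; exact: finite_setD.
have Ux : U x by move=> [_]; exact.
apply: lt_le_trans (sx.2 U oU Ux) _.
have mU : measurable U by exact: open_measurable.
have -> : mu [set x] = mu ([set x] `|` ~` supp I mu).
  by rewrite measureU0//; exact: measurableC.
apply: le_measure; rewrite ?inE; [exact: measurableI| |].
  by apply: measurableU => //; exact: measurableC.
move=> y [Uy _]; have [sy|] := pselect (supp I mu y); last by right.
by left; apply: contrapT => yx; apply: Uy.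
Qed.

End finite_support.

Lemma measure_on_integral {R : realType} (I : set R) (mu : {measure set R -> \bar R})
    (f : R -> \bar R) :
  measurable I -> measure_on I mu -> measurable_fun [set: R] f ->
  \int[mu]_(y in I) f y = \int[mu]_y f y.
Proof.
move=> mI muI mf; rewrite [RHS]integralE [LHS]integralE.
have ge0 (g : R -> \bar R) : measurable_fun [set: R] g -> (forall y, 0 <= g y) ->
    \int[mu]_(y in I) g y = \int[mu]_y g y.
  move=> mg g0; rewrite [RHS](@ge0_negligible_integral _ _ _ _ setT (~` I))//.
    by rewrite setTD setCK.
  exact: measurableC.
rewrite ge0 ?[in RHS]ge0//; first by rewrite ge0//; exact: measurable_funeneg.
exact: measurable_funepos.
Qed.

Section connected_part.
Context {R : realType} (I : set R).
Hypotheses (itvI : is_interval I) (oI : open I) (I0 : I !=set0).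
Variable gamma : {finite_measure set R -> \bar R}.
Hypothesis gammaI : measure_on I gamma.

Let mI : measurable I. Proof. exact: is_interval_measurable. Qed.

Let fin : gamma setT < +oo.
Proof. by rewrite -ge0_fin_numE ?measure_ge0// fin_num_measure. Qed.

Lemma measure_on_mass : gamma I = (mass gamma)%:E.
Proof.
by have := measure_on_setI mI measurableT gammaI; rewrite setTI massE.
Qed.

Lemma connected_part_image (rho : {measure set R -> \bar R}) :
  is_connected_part I gamma rho ->
  exists a b : R, [/\ (0 <= a)%R, (a <= b)%R, (b <= mass gamma)%R,
    rho I = (b - a)%:E & is_image leb `]a, b[ (quantile gamma) rho].
Proof.
move=> [a [b [a0 ab bM rhoE]]]; exists a, b; split => //.
- by rewrite -lee_fin -measure_on_mass.
- exact: (quantile_restriction_total itvI oI I0 a0 ab bM rhoE).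
- exact: (quantile_restriction_image itvI oI I0 gammaI a0 ab bM rhoE).
Qed.

Hypothesis mean : (gamma : {measure set R -> \bar R}).-integrable [set: R] EFin.

Lemma connected_part_unique (m c : \bar R) (rho rho' : {measure set R -> \bar R}) :
  is_connected_part_with I gamma m c rho ->
  is_connected_part_with I gamma m c rho' ->
  forall B, measurable B -> rho B = rho' B.
Proof.
have part r : is_connected_part I gamma r -> measure_on I r.
  by case=> a [b [_ _ _ []]].
move=> [rp rm rc] [rp' rm' rc'].
have rI := part _ rp; have rI' := part _ rp'.
have [a [b [a0 ab bM rIE rE]]] := connected_part_image rp.
have [a' [b' [a0' ab' bM' rIE' rE']]] := connected_part_image rp'.
apply: (quantile_part_unique fin mean a0 ab bM a0' ab' bM' _ rE rE').
  by apply/EFin_inj; rewrite -rIE -rIE' rm.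
rewrite -(measure_on_integral mI rI)// -(measure_on_integral mI rI')//.
by rewrite rc rc'.
Qed.

End connected_part.

Definition vline {R : realType} (x : R) : set (R * R) := fst @^-1` [set x].

Section slices.
Context {R : realType}.
Implicit Types (x : R) (nu : {measure set (R * R) -> \bar R}).

Lemma measurable_vline x : measurable (vline x).
Proof. by rewrite -[X in measurable X]setTI; exact: measurable_fst. Qed.

Lemma measurable_preimage_fst (B : set R) : measurable B ->
  measurable (fst @^-1` B : set (R * R)).
Proof. by move=> mB; rewrite -[X in measurable X]setTI; exact: measurable_fst. Qed.

Lemma measurable_preimage_snd (B : set R) : measurable B ->
  measurable (snd @^-1` B : set (R * R)).
Proof. by move=> mB; rewrite -[X in measurable X]setTI; exact: measurable_snd. Qed.

Lemma dirac_prod1E x (rho : {finite_measure set R -> \bar R}) (A : set (R * R)) :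
  measurable A -> (\d_x \x rho) A = rho (xsection A x).
Proof.
move=> mA; rewrite /product_measure1/= integral_dirac//; last first.
  exact: measurable_fun_xsection.
by rewrite diracT mul1e.
Qed.

End slices.

(** * Martingale couplings with a finitely supported first marginal *)

Section martingale.
Context {R : realType} (I : set R) (l1 l2 : probability R R).
Hypotheses (itvI : is_interval I) (mean1 : finite_mean l1) (mean2 : finite_mean l2).
Context {n : nat} (J : 'I_n -> R).
Hypotheses (Jinj : injective J) (l1J : l1 (~` range J) = 0).

Let mI : measurable I. Proof. exact: is_interval_measurable. Qed.

Let l1m : {measure set R -> \bar R} := l1.

Let disjointJ i j : i != j -> [set J i] `&` [set J j] = set0.
Proof.
move=> ij; apply/seteqP; split => // x [/= -> /Jinj jE].
by move: ij; rewrite jE eqxx.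
Qed.

Let disjointV i j : i != j -> vline (J i) `&` vline (J j) = set0.
Proof.
by move=> ij; rewrite /vline -preimage_setI disjointJ// preimage_set0.
Qed.

Let bigcupJ : \bigcup_i [set J i] = range J.
Proof. by apply/seteqP; split => [x [i _ ->]|x [i _ <-]]; exists i. Qed.

Let bigcupV : \bigcup_i vline (J i) = fst @^-1` range J.
Proof. by rewrite -bigcupJ preimage_bigcup. Qed.

Let l1JU : l1m (~` \bigcup_i [set J i]) = 0.
Proof. by rewrite bigcupJ. Qed.

Lemma atoms_finite_carrier B : measurable B ->
  l1 B = \sum_(i < n) l1 (B `&` [set J i]).
Proof. by move=> mB; apply: (measure_finite_carrier _ disjointJ l1JU). Qed.

Lemma integral_atoms (f : R -> R) : l1m.-integrable setT (EFin \o f) ->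
  \int[l1m]_x (f x)%:E = \sum_(i < n) l1 [set J i] * (f (J i))%:E.
Proof.
move=> intf.
rewrite (integral_finite_carrier _ disjointJ l1JU)//.
apply: eq_bigr => i _; rewrite setTI.
rewrite (eq_integral (cst (f (J i))%:E)); last by move=> x /[!inE] ->.
by rewrite integral_cst// muleC.
Qed.

Lemma slice_of_sum (nu : {measure set (R * R) -> \bar R})
    (nu_ : 'I_n -> {finite_measure set R -> \bar R}) i :
  (forall B : set (R * R), measurable B ->
     nu B = \sum_(i < n) (\d_(J i) \x nu_ i) B) ->
  is_image nu (vline (J i)) snd (nu_ i).
Proof.
move=> nuE B mB; rewrite nuE; last first.
  by apply: measurableI; [exact: measurable_vline|exact: measurable_preimage_snd].
rewrite (bigD1 i)//= dirac_prod1E; last first.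
  by apply: measurableI; [exact: measurable_vline|exact: measurable_preimage_snd].
rewrite big1 ?adde0 => [|j ji].
  by congr (nu_ i _); apply/seteqP; split => y; rewrite /xsection /= inE => // -[].
rewrite dirac_prod1E; last first.
  by apply: measurableI; [exact: measurable_vline|exact: measurable_preimage_snd].
rewrite (_ : xsection _ _ = set0) ?measure0//.
apply/seteqP; split => y //; rewrite /xsection/= inE => -[/Jinj ij].
by rewrite ij eqxx in ji.
Qed.

(** The line over [x] belongs to the sigma-algebra of the first coordinate, so the identity defining
    the conditional expectation may be integrated over it, where [Y] is almost everywhere the
    constant [x]. *)
Lemma martingale_slice nu x (rho : {measure set R -> \bar R}) :
  martingale_coupling I l1 l2 nu -> is_image nu (vline x) snd rho ->
  [/\ measure_on I rho, rho setT = l1 [set x], rho.-integrable setT EFin &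
      \int[rho]_y y%:E = l1 [set x] * x%:E].
Proof.
move=> [nuI nuT nu1 nu2 [Y [iX iY mY EY] YE]] rhoE.
have mV := measurable_vline x.
have nuV : nu (vline x) = l1 [set x] by rewrite -nu1.
split.
- rewrite /measure_on rhoE; last exact: measurableC.
  apply: subset_measure0 nuI.
  + by apply: measurableI => //; apply: measurable_preimage_snd; exact: measurableC.
  + by apply: measurableC; exact: measurableX.
  + by move=> [u v] [_ /= nIv] [].
- by rewrite rhoE// preimage_setT setIT.
- apply/(integrable_image mV (@measurable_snd _ _ _ _) rhoE) => //.
  exact: integrableS iX.
rewrite (integral_image mV (@measurable_snd _ _ _ _) rhoE)//.
have GV : sigma_of (fst : R * R -> R) (vline x).
  by exists [set x] => //; rewrite setTI.
rewrite -(EY _ GV).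
rewrite (ae_eq_integral (cst x%:E))//.
- by rewrite integral_cst// nuV muleC.
- by case/integrableP : iY => + _; apply: measurable_funS.
- by move: YE; apply: filterS => w /= -> <-.
Qed.

(** The first coordinate itself serves as conditional expectation. A set it generates contains each
    line [vline (J i)] or misses it, so the martingale identity reduces to the means of the
    slices. *)
Lemma martingale_of_slices (nu : {measure set (R * R) -> \bar R})
    (nu_ : 'I_n -> {finite_measure set R -> \bar R}) :
  measure_on (I `*` I) nu ->
  (forall B : set (R * R), measurable B ->
     nu B = \sum_(i < n) (\d_(J i) \x nu_ i) B) ->
  (forall i, nu_ i setT = l1 [set J i]) ->
  (forall i, \int[nu_ i]_y y%:E = l1 [set J i] * (J i)%:E) ->
  (forall B, measurable B -> \sum_(i < n) nu_ i B = l2 B) ->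
  martingale_coupling I l1 l2 nu.
Proof.
move=> nuI nuE nuT numean nul2.
have nuXE A : measurable A -> nu A = \sum_(i < n) nu_ i (xsection A (J i)).
  by move=> mA; rewrite nuE//; apply: eq_bigr => i _; rewrite dirac_prod1E.
have mf := @measurable_preimage_fst R.
have ms := @measurable_preimage_snd R.
have nu1 B : measurable B -> pushforward nu fst B = l1 B.
  move=> mB; rewrite /pushforward nuXE; last exact: mf.
  rewrite atoms_finite_carrier//; apply: eq_bigr => i _.
  have [BJ|BJ] := pselect (B (J i)).
    rewrite (_ : xsection _ _ = setT); last first.
      by apply/seteqP; split => // y _; rewrite /xsection/= inE.
    by rewrite nuT setIidr// => y ->.
  rewrite (_ : xsection _ _ = set0); last first.
    by apply/seteqP; split => // y; rewrite /xsection/= inE.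
  rewrite measure0 (_ : _ `&` _ = set0) ?measure0//.
  by apply/seteqP; split => // y [+ yJ]; rewrite yJ.
have nu2 B : measurable B -> pushforward nu snd B = l2 B.
  move=> mB; rewrite /pushforward nuXE; last exact: ms.
  rewrite -nul2//; apply: eq_bigr => i _; congr (nu_ i _).
  by apply/seteqP; split => y; rewrite /xsection/= inE.
have i1 : nu.-integrable setT (EFin \o fst).
  have im : is_image nu setT fst l1m by move=> B mB; rewrite setTI; exact: esym (nu1 B mB).
  by apply/(integrable_image measurableT (@measurable_fst _ _ _ _) im).
have i2 : nu.-integrable setT (EFin \o snd).
  have im : is_image nu setT snd l2 by move=> B mB; rewrite setTI; exact: esym (nu2 B mB).
  by apply/(integrable_image measurableT (@measurable_snd _ _ _ _) im).
split => //.
- by rewrite -[LHS]/(pushforward nu fst setT) nu1// probability_setT.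
exists fst; last by apply: aeW.
split => //.
  by move=> B mB; exists B => //; rewrite setTI.
move=> _ [B mB <-]; rewrite setTI.
have nuV : nu (~` \bigcup_i vline (J i)) = 0.
  rewrite bigcupV preimage_setC -[LHS]/(pushforward nu fst (~` range J)) nu1//.
  by rewrite -bigcupJ; apply: measurableC; apply: fin_bigcup_measurable.
have mVi i : measurable (vline (J i)) := measurable_vline _.
rewrite (integral_finite_carrier mVi disjointV nuV (f := fst))//; last 2 first.
- exact: mf.
- by apply: integrableS i1 => //; exact: mf.
rewrite (integral_finite_carrier mVi disjointV nuV (f := snd))//; last 2 first.
- exact: mf.
- by apply: integrableS i2 => //; exact: mf.
apply: eq_bigr => i _.
have [BJ|BJ] := pselect (B (J i)); last first.
  rewrite (_ : _ `&` _ = set0) ?integral_set0//.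
  by apply/seteqP; split => // -[u v] []; rewrite /vline/= => + uJ; rewrite uJ.
rewrite (_ : _ `&` _ = vline (J i)); last first.
  by apply/seteqP; split => [x []//|[u v]]; rewrite /vline/= => uJ; split => //=; rewrite uJ.
have im := slice_of_sum i nuE.
rewrite -(integral_image (mVi i) (@measurable_snd _ _ _ _) im)//.
rewrite [RHS]numean (eq_integral (cst (J i)%:E)); last by move=> x /[!inE] ->.
rewrite integral_cst// muleC; congr (_ * _).
by rewrite -nuT im// preimage_setT setIT.
Qed.

End martingale.

(** * From decompositions to curtain couplings *)

(* [C] is the hull of the part [rho] of [gamma] and [D] its interior: [rho]
   exhausts [gamma] on [D]. *)
Lemma quantile_part_hull {R : realType} (gamma rho : {measure set R -> \bar R})
    (a b : R) : gamma setT < +oo ->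
  (0 <= a)%R -> (b <= mass gamma)%R ->
  is_image leb `]a, b[ (quantile gamma) rho ->
  exists C D : set R, [/\ measurable C, measurable D, rho (~` C) = 0,
    rho D = gamma D &
    forall y1 y y2, C y1 -> C y2 -> (y1 < y < y2)%R -> D y].
Proof.
move=> fin a0 bM rhoE; set q := quantile gamma in rhoE *.
pose C := [set y | exists u v, [/\ (a < u < b)%R, (a < v < b)%R & (q u <= y <= q v)%R]].
pose D := [set y | exists u v, [/\ (a < u < b)%R, (a < v < b)%R & (q u < y < q v)%R]].
have mC : measurable C.
  apply: is_interval_measurable => x y [u [_ [uab _ /andP[ux _]]]] [_ [v [_ vab /andP[_ yv]]]].
  move=> z /andP[xz zy]; exists u, v; split => //.
  by rewrite (le_trans ux xz) (le_trans zy yv).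
have mD : measurable D.
  apply: is_interval_measurable => x y [u [_ [uab _ /andP[ux _]]]] [_ [v [_ vab /andP[_ yv]]]].
  move=> z /andP[xz zy]; exists u, v; split => //.
  by rewrite (lt_le_trans ux xz) (le_lt_trans zy yv).
exists C, D; split => //.
- rewrite rhoE; last exact: measurableC.
  rewrite (_ : _ `&` _ = set0) ?measure0//; apply/seteqP; split => // u [].
  rewrite /= in_itv/= => uab; apply; exists u, u; split => //.
  by rewrite lexx.
- rewrite rhoE// (quantile_image fin)//; congr (lebesgue_measure _).
  apply/seteqP; split => w [] /=; rewrite !in_itv/= => /andP[w1 w2] Dw; split => //.
    by rewrite (le_lt_trans a0 w1) (lt_le_trans w2 bM).
  (* By monotonicity, a level whose quantile lies strictly between those of two levels of the window
     is in the window too. *)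
  case: Dw => u [v [/andP[au ub] /andP[av vb] /andP[uw wv]]].
  apply/andP; split; rewrite ltNge; apply/negP => H.
    move: uw; rewrite ltNge => /negP; apply; apply: quantile_nd => //; last first.
      exact: lt_le_trans bM.
    exact/ltW/(le_lt_trans H).
  move: wv; rewrite ltNge => /negP; apply; apply: quantile_nd => //.
    exact: le_lt_trans av.
  exact/ltW/(lt_le_trans vb).
- move=> y1 y y2 [u [_ [uab _ /andP[uy1 _]]]] [_ [v [_ vab /andP[_ y2v]]]].
  move=> /andP[y1y yy2]; exists u, v; split => //.
  by rewrite (le_lt_trans uy1 y1y) (lt_le_trans yy2 y2v).
Qed.

Section successive_parts.
Local Open Scope ring_scope.
Context {R : realType} {n : nat}.
Variables (r : 'I_n -> R) (L : R).
Hypothesis r0 : forall i, 0 <= r i.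

(** To be read with [L] the [l2]-mass of a set and [r i] its mass under part [i]. The inequality at
    the last index already bounds the whole sum. *)
Lemma successive_parts_le : 0 <= L ->
  (forall k, r k <= L - \sum_(j < n | (j < k)%N) r j) -> \sum_(i < n) r i <= L.
Proof.
case: n r r0 => [|m] r' r0' L0 H; first by rewrite big_ord0.
rewrite (bigD1 ord_max)//= -lerBrDr (le_trans (H ord_max))// lerD2l lerN2.
rewrite [leLHS]big_mkcond [leRHS]big_mkcond; apply: ler_sum => i _ /=.
case: ifPn => [im|//]; case: ifPn => // /negP[].
by rewrite ltn_neqAle -ltnS ltn_ord andbT.
Qed.

(** Applied to the interior of the hull of part [j], it shows that no later part charges that
    interior. *)
Lemma successive_parts_eq0 (j k : 'I_n) : (j < k)%N ->
  r j = L - \sum_(i < n | (i < j)%N) r i ->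
  r k <= L - \sum_(i < n | (i < k)%N) r i -> r k = 0.
Proof.
move=> jk rj rk; apply/eqP; rewrite eq_le r0 andbT; apply: le_trans rk _.
rewrite subr_le0 (bigD1 j)//= rj addrAC -addrA lerDl subr_ge0.
rewrite [leLHS]big_mkcond [leRHS]big_mkcond; apply: ler_sum => i _ /=.
case: ifPn => [ij|_]; last by case: ifP.
by rewrite (ltn_trans ij jk)/= -val_eqE/= (ltn_eqF ij).
Qed.

End successive_parts.

Section decomposition_curtain.
Context {R : realType} (I : set R) (l1 l2 : probability R R) (n : nat).
Hypotheses (itvI : is_interval I) (oI : open I) (I0 : I !=set0).
Hypotheses (l2I : measure_on I l2).
Hypotheses (mean1 : finite_mean l1) (mean2 : finite_mean l2).
Variable J : 'I_n -> R.
Hypotheses (Jinj : injective J) (JI : forall i, I (J i)) (l1J : l1 (~` range J) = 0).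
Variable nu : {measure set (R * R) -> \bar R}.
Hypothesis nuI : measure_on (I `*` I) nu.
Variable nu_ : 'I_n -> {finite_measure set R -> \bar R}.
Hypothesis nuE : forall B : set (R * R), measurable B ->
  nu B = \sum_(i < n) (\d_(J i) \x nu_ i) B.
Hypothesis nu_part : forall i : 'I_n, exists gamma : {finite_measure set R -> \bar R},
  (forall B : set R, measurable B ->
     gamma B = l2 B - \sum_(j < n | (j < i)%N) nu_ j B) /\
  is_connected_part_with I gamma (l1 [set J i]) (l1 [set J i] * (J i)%:E) (nu_ i).

Let mI : measurable I. Proof. exact: is_interval_measurable. Qed.

Let r B i : R := fine (nu_ i B).
Let L2 B : R := fine (l2 B).

Let rE B i : measurable B -> nu_ i B = (r B i)%:E.
Proof. by move=> mB; rewrite fineK// fin_num_measure. Qed.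

Let r_ge0 B i : (0 <= r B i)%R. Proof. exact: fine_ge0. Qed.

Let L2E B : measurable B -> l2 B = (L2 B)%:E.
Proof. by move=> mB; rewrite fineK// fin_num_measure. Qed.

Let remainderE B k : measurable B ->
  l2 B - \sum_(j < n | (j < k)%N) nu_ j B = (L2 B - \sum_(j < n | (j < k)%N) r B j)%:E.
Proof.
move=> mB; rewrite L2E// EFinB -sumEFin; congr (_ - _).
by apply: eq_bigr => j _; rewrite rE.
Qed.

(** [CD.1] is the hull of the part and [CD.2] its interior; the last equation of the first group
    says that the part takes all that is left in [CD.2]. *)
Let nu_spec (i : 'I_n) : exists CD : set R * set R,
  [/\ measurable CD.1, measurable CD.2, nu_ i (~` CD.1) = 0,
    forall y1 y y2, CD.1 y1 -> CD.1 y2 -> (y1 < y < y2)%R -> CD.2 y &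
    r CD.2 i = (L2 CD.2 - \sum_(j < n | (j < i)%N) r CD.2 j)%R] /\
  [/\ forall B, measurable B -> (r B i <= L2 B - \sum_(j < n | (j < i)%N) r B j)%R,
    measure_on I (nu_ i), nu_ i setT = l1 [set J i] &
    \int[nu_ i]_y y%:E = l1 [set J i] * (J i)%:E].
Proof.
have [gamma [gammaE [part m c]]] := nu_part i.
pose g : {measure set R -> \bar R} := gamma.
have gE B : measurable B -> g B = (L2 B - \sum_(j < n | (j < i)%N) r B j)%:E.
  by move=> mB; rewrite -remainderE//; exact: gammaE.
have gle B : measurable B -> g B <= l2 B.
  move=> mB; rewrite gE// L2E// lee_fin gerBl sumr_ge0// => j _; exact: r_ge0.
have gI : measure_on I g.
  apply/eqP; rewrite -measure_le0 -l2I; apply: gle; exact: measurableC.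
have gfin : g setT < +oo by rewrite gE// ltry.
have partI : measure_on I (nu_ i) by case: part => a [b [_ _ _ []]].
have [a [b [a0 ab bM rhoI rhoE]]] := connected_part_image itvI oI I0 gI part.
have [C [D [mC mD nuC nuD CD]]] := quantile_part_hull gfin a0 bM rhoE.
exists (C, D) => /=; split; split => //.
- by apply/EFin_inj; rewrite -gE// -nuD -rE.
- move=> B mB; rewrite -lee_fin -gE// -rE//.
  apply: (image_quantile_le gfin _ _ rhoE) => //.
  by apply: subset_itv; rewrite bnd_simp.
- have := measure_on_setI mI measurableT partI; rewrite setTI => nuT.
  by rewrite -m; exact: esym nuT.
- by rewrite -(measure_on_integral mI partI).
Qed.

Let sum_le B : measurable B -> (\sum_(i < n) r B i <= L2 B)%R.
Proof.
move=> mB; apply: successive_parts_le => [i||k]; [exact: r_ge0|exact: fine_ge0|].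
by have [CD [_ [H _ _ _]]] := nu_spec k; exact: H.
Qed.

(** The parts give each set at most its [l2]-mass, and the total masses agree because the atoms
    carry [l1]; comparing on [B] and on its complement forces equality. *)
Lemma decomposition_sum B : measurable B -> \sum_(i < n) nu_ i B = l2 B.
Proof.
move=> mB; have mBC : measurable (~` B) by exact: measurableC.
have sumT : (\sum_(i < n) r setT i = L2 setT)%R.
  apply/EFin_inj; rewrite -L2E// probability_setT -sumEFin.
  rewrite -(@probability_setT _ _ _ l1) (atoms_finite_carrier Jinj l1J)//.
  apply: eq_bigr => i _; rewrite setTI -rE//.
  by have [CD [_ [_ _ -> _]]] := nu_spec i.
have sumC i : r setT i = (r B i + r (~` B) i)%R.
  apply/EFin_inj; rewrite EFinD -!rE// -measureU ?setUv//.
  by rewrite setICr.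
have L2C : L2 setT = (L2 B + L2 (~` B))%R.
  apply/EFin_inj; rewrite EFinD -!L2E// -measureU ?setUv//.
  by rewrite setICr.
rewrite L2E//; under eq_bigr do rewrite rE//.
rewrite sumEFin; congr (_%:E); apply/eqP; rewrite eq_le sum_le//=.
have := sum_le mBC; move: sumT.
by rewrite (eq_bigr _ (fun i _ => sumC i)) big_split/= L2C; lra.
Qed.

Lemma decomposition_martingale : martingale_coupling I l1 l2 nu.
Proof.
apply: (martingale_of_slices mean1 mean2 Jinj l1J nuI nuE).
- by move=> i; have [CD [_ [_ _ -> _]]] := nu_spec i.
- by move=> i; have [CD [_ [_ _ _ ->]]] := nu_spec i.
- exact: decomposition_sum.
Qed.

Lemma decomposition_curtain : curtain_martingale_coupling I l1 l2 nu.
Proof.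
split; first exact: decomposition_martingale.
have [CD CDE] := choice nu_spec.
pose E i := I `&` (CD i).1 `&` \bigcap_(j in [set j : 'I_n | (j < i)%N]) ~` (CD j).2.
have mE i : measurable (E i).
  have [[mC _ _ _ _] _] := CDE i.
  apply: measurableI; first exact: measurableI.
  apply: fin_bigcap_measurable => // j _; apply: measurableC.
  by have [[_ mD _ _ _] _] := CDE j.
have nuE0 i : nu_ i (~` E i) = 0.
  have [[mC _ nuC _ _] [_ nuiI _ _]] := CDE i.
  have aeE : {ae nu_ i, forall y, E i y}.
    have aeI : {ae nu_ i, forall y, I y} by apply/negligibleP => //; exact: measurableC.
    have aeC : {ae nu_ i, forall y, (CD i).1 y} by apply/negligibleP => //; exact: measurableC.
    have aeD : {ae nu_ i, forall y, forall j : 'I_n, (j < i)%N -> ~ (CD j).2 y}.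
      apply: filter_forall => j; have [ij|ij] := ltnP j i; last exact: aeW.
      have [[_ mD _ _ jD] _] := CDE j; have [_ [le_i _ _ _]] := CDE i.
      have riD : r (CD j).2 i = 0%R.
        exact: (successive_parts_eq0 (r_ge0 _) ij jD (le_i _ mD)).
      exists (CD j).2; split => //; first by rewrite rE// riD.
      by move=> y /= /not_implyP[_ /contrapT].
    apply: filterS3 aeI aeC aeD => y Iy Cy Dy.
    by split; [split|move=> j /= ji; exact: Dy].
  by apply/negligibleP; [exact: measurableC|exact: aeE].
pose Gamma := \bigcup_i (vline (J i) `&` snd @^-1` E i).
have mGamma : measurable Gamma.
  apply: fin_bigcup_measurable => // i _; apply: measurableI.
    exact: measurable_vline.
  exact: measurable_preimage_snd.
have nuT : nu setT = 1 by have [] := decomposition_martingale.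
have GammaP x y : Gamma (x, y) -> exists2 i, x = J i & E i y.
  by move=> [i _ [/= xJ Ey]]; exists i.
have cross (i k : 'I_n) y1 y2 y' : (i < k)%N -> E i y1 -> E i y2 -> E k y' ->
    (y1 < y' < y2)%R -> False.
  move=> ik [[_ C1] _] [[_ C2] _] [_ Dy'] yy.
  have [[_ _ _ CDi _] _] := CDE i.
  by apply: (Dy' i ik); exact: CDi yy.
exists Gamma; split => //.
- by move=> [x y] /GammaP[i -> [[Iy _] _]]; split => /=.
- have nuGC : nu (~` Gamma) = 0.
    rewrite nuE; last exact: measurableC.
    rewrite big1// => i _; rewrite dirac_prod1E; last exact: measurableC.
    apply: (@subset_measure0 _ _ _ (nu_ i) _ (~` E i)) => //.
    + by apply: measurable_xsection; exact: measurableC.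
    + exact: measurableC.
    + by move=> y; rewrite /xsection/= inE => H Ey; apply: H; exists i.
    + exact: nuE0.
  by move: nuT; rewrite -(setUv Gamma) measureU0//; exact: measurableC.
- move=> x y y1 y2 x' y' y1' y2' sub [xx' yy yy'].
  have /GammaP[i xi Ey] : Gamma (x, y) by apply: sub => /=; tauto.
  have /GammaP[i1 xi1 Ey1] : Gamma (x, y1) by apply: sub => /=; tauto.
  have /GammaP[i2 xi2 Ey2] : Gamma (x, y2) by apply: sub => /=; tauto.
  have /GammaP[k xk Ey'] : Gamma (x', y') by apply: sub => /=; tauto.
  have /GammaP[k1 xk1 Ey1'] : Gamma (x', y1') by apply: sub => /=; tauto.
  have /GammaP[k2 xk2 Ey2'] : Gamma (x', y2') by apply: sub => /=; tauto.
  have ii1 : i1 = i by apply: Jinj; rewrite -xi1.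
  have ii2 : i2 = i by apply: Jinj; rewrite -xi2.
  have kk1 : k1 = k by apply: Jinj; rewrite -xk1.
  have kk2 : k2 = k by apply: Jinj; rewrite -xk2.
  subst i1 i2 k1 k2.
  (* Whichever index comes first, one of the two betweenness conditions puts a point of the later
     fibre strictly inside the hull of the earlier one. *)
  have [ik|ki|ik] := ltngtP i k.
  + exact: (cross _ _ _ _ _ ik Ey1 Ey2 Ey').
  + exact: (cross _ _ _ _ _ ki Ey1' Ey2' Ey).
  + by move: xx'; rewrite xi xk (val_inj ik) eqxx.
Qed.

End decomposition_curtain.

(** * From curtain couplings to decompositions *)

(* Sort by the number of predecessors. *)
Lemma linear_extension (n : nat) (prec : rel 'I_n) :
  irreflexive prec -> transitive prec ->
  exists2 s : 'I_n -> 'I_n, injective s &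
    forall i j : 'I_n, (i < j)%N -> ~~ prec (s j) (s i).
Proof.
move=> irr tr; pose h i := #|[pred j | prec j i]|.
have hlt i j : prec i j -> (h i < h j)%N.
  move=> ij; apply: proper_card; apply/properP; split.
    by apply/fintype.subsetP => k; rewrite !inE => ki; exact: tr ij.
  by exists i; rewrite !inE ?irr.
pose s := sort (relpre h leq) (enum 'I_n).
have ss : size s = n by rewrite size_sort size_enum_ord.
have us : uniq s by rewrite sort_uniq enum_uniq.
have so : sorted (relpre h leq) s by apply: sort_sorted => i j; exact: leq_total.
(* The default of [nth] is immaterial, as [s] has size [n]. *)
exists (fun i => nth i s i) => [i j|i j ij].
  rewrite (set_nth_default i) ?ss// => /eqP.
  by rewrite nth_uniq ?ss// => /eqP/val_inj.
apply/negP => /hlt; rewrite ltnNge => /negP; apply.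
rewrite (set_nth_default j i) ?ss//.
apply: (@sorted_leq_nth _ (relpre h leq) _ _ j s so); rewrite ?inE ?ss//.
- by move=> a b c; exact: leq_trans.
- by move=> a; exact: leqnn.
- exact: ltnW.
Qed.

Section carried_part.
Context {R : realType}.
Variables (gamma theta kappa : {measure set R -> \bar R}) (G : set R).
Hypothesis fin : gamma setT < +oo.
Hypothesis gammaE : forall B, measurable B -> gamma B = theta B + kappa B.
Hypotheses (mG : measurable G) (G0 : G !=set0) (thetaG : theta (~` G) = 0).
Hypothesis kappaG : forall y1 x y2, G y1 -> G y2 -> (x < y2)%R ->
  kappa `]y1, x]%classic = 0.

(* [a] is the mass of [kappa] to the left of [G]; it is an infimum because [G]
   need not contain its left end point, where [kappa] may have an atom. *)
Lemma carried_quantile_part : exists a : R,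
  [/\ (0 <= a)%R, (a + mass theta <= mass gamma)%R &
  forall x, theta `]-oo, x]%classic =
    (Num.min (Num.max (dfun gamma x - a) 0) (mass theta))%:E].
Proof.
have tfin : theta setT < +oo.
  by apply: le_lt_trans fin; rewrite gammaE// leeDl.
have kfin : kappa setT < +oo.
  by apply: le_lt_trans fin; rewrite gammaE// leeDr.
pose K := dfun kappa; pose T := dfun theta.
have gE x : dfun gamma x = (T x + K x)%R.
  by apply/EFin_inj; rewrite EFinD -!dfunE// gammaE.
have mE : mass gamma = (mass theta + mass kappa)%R.
  by apply/EFin_inj; rewrite EFinD -!massE// gammaE.
pose a := inf (K @` G); have [g0 Gg0] := G0.
have lbK : has_lbound (K @` G) by exists 0%R => _ [y _ <-]; exact: dfun_ge0.
have ale y : G y -> (a <= K y)%R by move=> Gy; apply: ge_inf => //; exists y.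
have gea c : (forall y, G y -> (c <= K y)%R) -> (c <= a)%R.
  move=> H; apply: lb_le_inf; first by exists (K g0); exists g0.
  by move=> _ [y Gy <-]; exact: H.
have theta0 (A : set R) : measurable A -> A `<=` ~` G -> theta A = 0.
  by move=> mA AG; apply: subset_measure0 thetaG => //; exact: measurableC.
exists a; split.
- by apply: gea => y _; exact: dfun_ge0.
- by rewrite mE addrC lerD2l (le_trans (ale _ Gg0))// dfun_le_mass.
move=> x; rewrite dfunE// gE -/T; congr (_%:E).
have T0 : (0 <= T x)%R by exact: dfun_ge0.
have Tm : (T x <= mass theta)%R by exact: dfun_le_mass.
(* Left of [G], [theta] has no mass and [K x <= a] clips to [0]. Right of [G], [theta] is complete
   and [a <= K x] clips to its mass. In between [kappa] does not grow, so [K x = a] and subtracting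
   [a] leaves exactly [T x]. *)
have [[y1 Gy1 y1x]|none] := pselect (exists2 y, G y & (y <= x)%R); last first.
  have Tx : T x = 0%R.
    apply/EFin_inj; rewrite -dfunE// theta0// => y /= /[!in_itv]/= yx Gy.
    by apply: none; exists y.
  have Ka : (K x <= a)%R.
    apply: gea => y Gy; apply: dfun_nd => //; rewrite leNgt; apply/negP => yx.
    by apply: none; exists y => //; exact: ltW.
  rewrite Tx in Tm *; rewrite max_r ?min_l//; lra.
have aK : (a <= K x)%R by apply: le_trans (ale _ Gy1) _; exact: dfun_nd.
have [[y2 Gy2 xy2]|none] := pselect (exists2 y, G y & (x < y)%R).
  have Ka : K x = a.
    apply/eqP; rewrite eq_le aK andbT; apply: gea => y Gy.
    have [xy|yx] := leP x y; first exact: dfun_nd.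
    rewrite -lee_fin -!dfunE//.
    rewrite (@itv_bndbnd_setU _ _ -oo%O (BRight y) (BRight x)) ?bnd_simp ?(ltW yx)//.
    by rewrite measureU0// (kappaG Gy Gy2 xy2).
  rewrite Ka addrK max_l// min_l//.
have Tx : T x = mass theta.
  apply/EFin_inj; rewrite -dfunE// -massE// -(setUv `]-oo, x]%classic) measureU0//.
    exact: measurableC.
  apply: theta0; first exact: measurableC.
  move=> y /= /[!in_itv]/= /negP; rewrite -ltNge => xy Gy.
  by apply: none; exists y.
rewrite Tx max_l ?min_r//; lra.
Qed.

End carried_part.

Lemma curtain_order {R : realType} (n : nat) (J : 'I_n -> R) (Gamma : set (R * R)) :
  injective J ->
  (forall x y y1 y2 x' y' y1' y2' : R,
    [set (x, y); (x, y1); (x, y2); (x', y'); (x', y1'); (x', y2')] `<=` Gamma ->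
    ~ [/\ x != x', (y1 < y' < y2)%R & (y1' < y < y2')%R]) ->
  exists2 s : 'I_n -> 'I_n, injective s &
    forall i k : 'I_n, (i < k)%N -> forall y1 y y2,
      Gamma (J (s i), y1) -> Gamma (J (s i), y2) -> Gamma (J (s k), y) ->
      (y1 < y < y2)%R -> False.
Proof.
move=> Jinj cross.
have nc i j : i != j -> forall y y1 y2 y' z1 z2,
    Gamma (J i, y) -> Gamma (J i, y1) -> Gamma (J i, y2) ->
    Gamma (J j, y') -> Gamma (J j, z1) -> Gamma (J j, z2) ->
    (y1 < y' < y2)%R -> (z1 < y < z2)%R -> False.
  move=> ij y y1 y2 y' z1 z2 *.
  apply: (@cross (J i) y y1 y2 (J j) y' z1 z2).
    by move=> _ /= [[[[[->|->]|->]|->]|->]|->].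
  by split => //; apply: contra_neq ij => /Jinj.
pose prec : rel 'I_n := fun j i => (j != i) &&
  `[< exists y1 y y2, [/\ Gamma (J i, y1), Gamma (J i, y2), Gamma (J j, y) &
       (y1 < y < y2)%R] >].
have [||s sinj sP] := @linear_extension n prec.
- by move=> i; rewrite /prec eqxx.
- move=> j k i /andP[kj /asboolP[z1 [z [z2 [Gz1 Gz2 Gz zz]]]]].
  move=> /andP[ji /asboolP[y1 [y [y2 [Gy1 Gy2 Gy yy]]]]].
  have ij : i != j by rewrite eq_sym.
  have [y1y yy2] : (y1 < y)%R /\ (y < y2)%R by move/andP: yy.
  have [z1z zz2] : (z1 < z)%R /\ (z < z2)%R by move/andP: zz.
  (* If [z1 < y1], then [y1] lies between [z1] and [y] in the fibre over [J j], while [y] lies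
     between [y1] and [y2]: a forbidden crossing. The right end is symmetric, so [z] inherits the
     bounds [y1] and [y2]. *)
  have y1z1 : (y1 <= z1)%R.
    rewrite leNgt; apply/negP => H.
    apply: (nc i j ij y1 y1 y2 y z1 y) => //; exact/andP.
  have z2y2 : (z2 <= y2)%R.
    rewrite leNgt; apply/negP => H.
    apply: (nc i j ij y2 y1 y2 y y z2) => //; exact/andP.
  apply/andP; split.
    apply/negP => /eqP ki; rewrite ki in Gz.
    exact: (nc i j ij z y1 y2 y z1 z2).
  apply/asboolP; exists y1, z, y2; split => //.
  by rewrite (le_lt_trans y1z1 z1z) (lt_le_trans zz2 z2y2).
exists s => // i k ik y1 y y2 Gy1 Gy2 Gy yy.
have /negP := sP _ _ ik; apply; apply/andP; split.
  by apply/negP => /eqP/sinj ki; move: ik; rewrite ki ltnn.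
by apply/asboolP; exists y1, y, y2.
Qed.

Section curtain_decomposition.
Context {R : realType} (I : set R) (l1 l2 : probability R R) (n : nat).
Hypotheses (itvI : is_interval I) (oI : open I) (I0 : I !=set0).
Variable J : 'I_n -> R.
Hypotheses (Jinj : injective J) (l1J : l1 (~` range J) = 0).
Hypothesis l1J_gt0 : forall i, 0 < l1 [set J i].
Variable nu : {measure set (R * R) -> \bar R}.
Hypothesis nu_mart : martingale_coupling I l1 l2 nu.
Variable Gamma : set (R * R).
Hypotheses (mGamma : measurable Gamma) (nuGamma : nu Gamma = 1).
Hypothesis J_ordered : forall i k : 'I_n, (i < k)%N -> forall y1 y y2,
  Gamma (J i, y1) -> Gamma (J i, y2) -> Gamma (J k, y) -> (y1 < y < y2)%R -> False.

Let mI : measurable I. Proof. exact: is_interval_measurable. Qed.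

Let nuT : nu setT = 1. Proof. by case: nu_mart. Qed.

Let nu2 B : measurable B -> nu (snd @^-1` B) = l2 B.
Proof. by move=> mB; have [_ _ _ H _] := nu_mart; exact: H. Qed.

Let intsnd : nu.-integrable setT (EFin \o snd).
Proof. by have [_ _ _ _ [Y [+ _ _ _] _]] := nu_mart. Qed.

Let nuGammaC : nu (~` Gamma) = 0.
Proof.
have : nu setT = nu Gamma + nu (~` Gamma).
  rewrite -measureU ?setUv//; first exact: measurableC.
  by rewrite setICr.
rewrite nuT nuGamma => /(congr1 (fun z => z - 1)).
by rewrite addeAC subee// add0e => <-.
Qed.

Let mV i : measurable (vline (J i)). Proof. exact: measurable_vline. Qed.

Let disjointV i j : i != j -> vline (J i) `&` vline (J j) = set0.
Proof.
move=> ij; apply/seteqP; split => // x [/= xi xj].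
by move: ij; rewrite (Jinj (etrans (esym xi) xj)) eqxx.
Qed.

Let nuV : nu (~` \bigcup_i vline (J i)) = 0.
Proof.
have [_ _ nu1 _ _] := nu_mart.
have -> : ~` (\bigcup_i vline (J i)) = fst @^-1` (~` range J).
  apply/seteqP; split => [x nx [i _ xi]|x nx [i _ xi]]; apply: nx.
    by exists i.
  by exists i.
rewrite -[LHS]/(pushforward nu fst (~` range J)) nu1//.
apply: measurableC; rewrite (_ : range J = \bigcup_i [set J i]).
  exact: fin_bigcup_measurable.
by apply/seteqP; split => [x [i _ <-]|x [i _ ->]]; exists i.
Qed.

Let nu_fin (A : set (R * R)) : measurable A -> nu A < +oo.
Proof.
move=> mA; apply: (@le_lt_trans _ _ (nu setT)); last by rewrite nuT ltry.
by apply: le_measure; rewrite ?inE.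
Qed.

Lemma slices_exist : exists th : 'I_n -> {finite_measure set R -> \bar R},
  forall i, is_image nu (vline (J i)) snd (th i).
Proof.
have ex i := finite_image_exists (mV i) (@measurable_snd _ _ _ _) (nu_fin (mV i)).
by exists (fun i => sval (cid (ex i))) => i; exact: (svalP (cid (ex i))).
Qed.

Variable th : 'I_n -> {finite_measure set R -> \bar R}.
Hypothesis thE : forall i, is_image nu (vline (J i)) snd (th i).

Let thGamma i (A : set R) : measurable A ->
  (forall y, A y -> ~ Gamma (J i, y)) -> th i A = 0.
Proof.
move=> mA AG; rewrite thE//; apply: subset_measure0 nuGammaC.
- by apply: measurableI => //; exact: measurable_preimage_snd.
- exact: measurableC.
- by move=> [x y] []; rewrite /vline/= => -> Ay; exact: AG.
Qed.

(** What is left of [l2] before step [i] is a difference; realising it as the image of [nu] on the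
    lines of the remaining atoms shows that it is a measure and has a mean. *)
Let tail (P : pred 'I_n) : exists rho : {finite_measure set R -> \bar R},
  (forall B, measurable B -> rho B = \sum_(k < n | P k) th k B) /\
  (rho : {measure set R -> \bar R}).-integrable setT EFin.
Proof.
pose V := \bigcup_(k in [set k | P k]) vline (J k).
have mVP : measurable V by apply: fin_bigcup_measurable => // k _.
have [rho rhoE] := finite_image_exists mVP (@measurable_snd _ _ _ _) (nu_fin mVP).
exists rho; split; last first.
  apply/(integrable_image mVP (@measurable_snd _ _ _ _) rhoE) => //.
  exact: integrableS intsnd.
move=> B mB; rewrite rhoE// (measure_finite_carrier mV disjointV nuV); last first.
  by apply: measurableI => //; exact: measurable_preimage_snd.
rewrite [RHS]big_mkcond; apply: eq_bigr => k _; case: ifPn => Pk.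
  rewrite thE//; congr (nu _); apply/seteqP; split => [x [[_ xB] xk]|x [xk xB]] //.
  by split => //; split => //; exists k.
rewrite (_ : _ `&` _ = set0) ?measure0//; apply/seteqP; split => // x.
move=> [[[j /= Pj xj] _] xk]; move: Pk; rewrite -(_ : j = k) ?Pj//.
by apply: Jinj; rewrite -xj.
Qed.

Let th_spec i := martingale_slice itvI nu_mart (thE i).

(** The remainder splits as [th i] plus the tail [kappa] of later slices. With [G] the section of
    [Gamma] over [J i], the ordering of the fibres says that [kappa] has no mass between points of
    [G], which makes [th i] a clipped piece of the remainder. *)
Lemma slices_decomposition :
  (forall B : set (R * R), measurable B -> nu B = \sum_(i < n) (\d_(J i) \x th i) B) /\
  forall i : 'I_n, exists gamma : {finite_measure set R -> \bar R},
    (forall B : set R, measurable B ->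
       gamma B = l2 B - \sum_(j < n | (j < i)%N) th j B) /\
    is_unique_connected_part_with I gamma
      (l1 [set J i]) (l1 [set J i] * (J i)%:E) (th i).
Proof.
split=> [B mB|i].
  rewrite (measure_finite_carrier mV disjointV nuV mB); apply: eq_bigr => i _.
  rewrite dirac_prod1E// thE; last exact: measurable_xsection.
  congr (nu _); apply/seteqP; split => [[x y] [Bx xJ]|[x y] [xJ]].
    by split => //; rewrite /xsection/= inE -xJ.
  by rewrite /xsection/= inE -xJ.
have [gamma [gammaE igamma]] := tail (fun k : 'I_n => (i <= k)%N).
have [kappa [kappaE _]] := tail (fun k : 'I_n => (i < k)%N).
have [thI thT _ thmean] := th_spec i.
have thfin (B : set R) k : measurable B -> th k B \is a fin_num.
  by move=> mB; exact: fin_num_measure.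
exists gamma; split.
  move=> B mB; rewrite -nu2// (measure_finite_carrier mV disjointV nuV); last first.
    exact: measurable_preimage_snd.
  under eq_bigr do rewrite setIC -thE//.
  rewrite [X in X - _](bigID (fun k : 'I_n => (k < i)%N))/= addeAC subee ?add0e.
    rewrite gammaE//; apply: eq_bigl => k; exact: leqNgt.
  by apply/sum_fin_numP => k _ _; exact: thfin.
have gammaI : measure_on I gamma.
  rewrite /measure_on [LHS]gammaE; last exact: measurableC.
  by rewrite big1// => k _; have [] := th_spec k.
pose g : {measure set R -> \bar R} := gamma.
pose t : {measure set R -> \bar R} := th i.
pose kp : {measure set R -> \bar R} := kappa.
have gfin : g setT < +oo.
  by rewrite -ge0_fin_numE ?measure_ge0//; exact: fin_num_measure.
have gE B : measurable B -> g B = t B + kp B.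
  move=> mB; rewrite [LHS]gammaE// (bigD1 i)//=; congr (_ + _).
  rewrite [RHS]kappaE//; apply: eq_bigl => k.
  by rewrite ltn_neqAle andbC eq_sym.
pose G := xsection Gamma (J i).
have mG : measurable G by exact: measurable_xsection.
have GP y : G y = Gamma (J i, y) by rewrite /G /xsection/= inE.
have G0 : G !=set0.
  apply/set0P/eqP => G0; have : l1 [set J i] = 0.
    by rewrite -thT; apply: thGamma => // y _; rewrite -GP G0.
  by move=> l1Ji; have := l1J_gt0 i; rewrite l1Ji ltxx.
have tG : t (~` G) = 0.
  by apply: thGamma; [exact: measurableC|move=> y; rewrite -GP].
have kG y1 x y2 : G y1 -> G y2 -> (x < y2)%R -> kp `]y1, x]%classic = 0.
  rewrite !GP => Gy1 Gy2 xy2; rewrite [LHS]kappaE// big1// => k ik.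
  apply: thGamma => // y; rewrite /= in_itv/= => /andP[y1y yx] Gy.
  apply: (J_ordered ik Gy1 Gy2 Gy); rewrite y1y; exact: le_lt_trans xy2.
have [a [a0 aM aE]] := carried_quantile_part gfin gE mG G0 tG kG.
have tm0 : (0 <= mass t)%R by exact: fine_ge0.
have part : is_connected_part_with I gamma (l1 [set J i])
    (l1 [set J i] * (J i)%:E) (th i).
  split; last 2 first.
  - have := measure_on_setI mI measurableT thI; rewrite setTI => thIT.
    by rewrite -thT; exact: thIT.
  - by rewrite -thmean; apply: measure_on_integral.
  exists a, (a + mass t)%R; split => //; first by rewrite lerDl.
    by rewrite measure_on_mass// lee_fin.
  split => // x Ix; rewrite addrAC subrr add0r.
  have := aE x; rewrite EFin_min EFin_max EFinB -dfunE//.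
  rewrite -[in LHS](measure_on_setI mI (measurable_itv _) thI).
  by rewrite -(measure_on_setI mI (measurable_itv _) gammaI).
split => // rho' rho'P B mB.
exact: (connected_part_unique itvI oI I0 gammaI igamma rho'P part).
Qed.

End curtain_decomposition.

(** * Decompositions along a given enumeration *)

Lemma convex_function_call {R : realType} (I : set R) (t : R) :
  convex_function I (call t : R -> R).
Proof.
move=> p x y _ _.
(* The inequality over plain reals, to which the convex-combination form unfolds. *)
have H (c u v : R) : (0 <= c)%R -> (c <= 1)%R ->
    (call t (c * u + (1 - c) * v) <= c * call t u + (1 - c) * call t v)%R.
  move=> c0 c1; rewrite /call.
  have [?|?] := leP (c * u + (1 - c) * v - t)%R 0%R;
    have [?|?] := leP (u - t)%R 0%R; have [?|?] := leP (v - t)%R 0%R; nra.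
by apply: H.
Qed.

Lemma convex_function_id {R : realType} (I : set R) : convex_function I (idfun : R -> R).
Proof. by move=> p x y _ _. Qed.

Lemma convex_function_opp {R : realType} (I : set R) : convex_function I (-%R : R -> R).
Proof.
move=> p x y _ _.
have H (c u v : R) : (- (c * u + (1 - c) * v) <= c * - u + (1 - c) * - v)%R by lra.
exact: H.
Qed.

Lemma integrable_call {R : realType} (mu : {measure set R -> \bar R}) (t : R) :
  mu setT < +oo -> mu.-integrable [set: R] EFin ->
  mu.-integrable [set: R] (EFin \o call t).
Proof.
move=> fin imu.
rewrite (_ : EFin \o call t = (fun u => (u - t)%:E)^\+)%E; last first.
  by apply/funext => u; rewrite funeposE /= /call EFin_max.
apply: integrable_funepos => //.
rewrite (_ : (fun u => (u - t)%:E) = (EFin \- (EFin \o (fun=> t)))%E)//.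
apply: integrableB => //; apply/integrableP; split => //.
  exact: measurable_cst.
by rewrite integral_cst// lte_mul_pinfty// abse_fin_num.
Qed.

Lemma eq_connected_part_with {R : realType} (I : set R)
    (g g' : {finite_measure set R -> \bar R}) (m c : \bar R) (rho : {measure set R -> \bar R}) :
  measurable I -> (forall B, measurable B -> g B = g' B) ->
  is_connected_part_with I g m c rho -> is_connected_part_with I g' m c rho.
Proof.
move=> mI gg' [[a [b [a0 ab bM [rhoI rhoE]]]] rm rc]; split => //.
exists a, b; split => //; first by rewrite -gg'.
by split => // x Ix; rewrite rhoE// gg'//; exact: measurableI.
Qed.

Section existence.
Context {R : realType} (I : set R) (l1 l2 : probability R R) (n : nat).
Hypotheses (itvI : is_interval I) (oI : open I) (I0 : I !=set0).
Hypotheses (l1I : measure_on I l1) (l2I : measure_on I l2).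
Hypotheses (mean1 : finite_mean l1) (mean2 : finite_mean l2).
Variable J : 'I_n -> R.
Hypotheses (Jinj : injective J) (JI : forall i, I (J i)) (l1J : l1 (~` range J) = 0).
Hypothesis ord : convex_order I l1 l2.

Let mI : measurable I. Proof. exact: is_interval_measurable. Qed.

Let w i : R := fine (l1 [set J i]).
Let wE i : l1 [set J i] = (w i)%:E.
Proof. by rewrite fineK// fin_num_measure. Qed.
Let w0 i : (0 <= w i)%R. Proof. exact: fine_ge0. Qed.

Let l := [seq (w i, J i) | i <- enum 'I_n].

Let size_l : size l = n. Proof. by rewrite size_map size_enum_ord. Qed.

Let nth_l (i : 'I_n) : nth (0, 0)%R l i = (w i, J i).
Proof. by rewrite (nth_map i) ?size_enum_ord// nth_ord_enum. Qed.

Let l0 : all (fun p => 0 <= p.1)%R l.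
Proof. by apply/allP => _ /mapP[i _ ->] /=. Qed.

Let m1 : {measure set R -> \bar R} := l1.
Let m2 : {measure set R -> \bar R} := l2.

Let fin_prob (m : probability R R) : m setT < +oo.
Proof. by rewrite probability_setT ltry. Qed.

(** The identity and its opposite, both convex, turn the order into equality of means; the calls
    give the remaining inequalities. *)
Lemma atoms_dominated : dominates_discrete m2 l.
Proof.
have on1 (f : R -> R) : measurable_fun [set: R] f ->
    \int[l1]_(y in I) (f y)%:E = \int[m1]_y (f y)%:E.
  by move=> mf; apply: measure_on_integral => //; exact/measurable_EFinP.
have on2 (f : R -> R) : measurable_fun [set: R] f ->
    \int[l2]_(y in I) (f y)%:E = \int[m2]_y (f y)%:E.
  by move=> mf; apply: measure_on_integral => //; exact/measurable_EFinP.
have sumE (f : R -> R) : m1.-integrable setT (EFin \o f) ->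
    \int[m1]_y (f y)%:E = (\sum_(i < n) w i * f (J i))%:E.
  move=> ifm; rewrite (integral_atoms Jinj l1J ifm) -sumEFin.
  by apply: eq_bigr => i _; rewrite wE EFinM.
have mid : measurable_fun [set: R] (@idfun R) by exact: measurable_id.
have mopp : measurable_fun [set: R] (-%R : R -> R) by exact: oppr_measurable.
split.
- rewrite /weight big_map big_enum/= -sumEFin [LHS]probability_setT.
  rewrite -(@probability_setT _ _ _ l1) (atoms_finite_carrier Jinj l1J)//.
  by apply: eq_bigr => i _; rewrite setTI wE.
- exact: mean2.
- have momentE : moment l = (\sum_(i < n) w i * J i)%R.
    by rewrite /moment big_map big_enum.
  have := ord (@convex_function_id _ I); rewrite on1// on2// sumE//.
  have := ord (@convex_function_opp _ I); rewrite on1// on2//.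
  have opp (m : {measure set R -> \bar R}) : m.-integrable setT EFin ->
      \int[m]_y (- y)%:E = - \int[m]_y y%:E.
    by move=> im; under eq_integral do rewrite EFinN; rewrite integralN//; exact: integrable_add_def.
  rewrite !opp// sumE// leeN2 momentE => H1 H2.
  by apply/eqP; rewrite eq_le H1 H2.
- move=> t; rewrite -on2; last exact: measurable_call.
  apply: (le_trans _ (ord (@convex_function_call _ I t))).
  rewrite on1; last exact: measurable_call.
  rewrite sumE; last exact: (@integrable_call _ m1 t (fin_prob l1) mean1).
  by rewrite /callsum big_map big_enum.
Qed.

Lemma sequential_decomposition_exists :
  exists nu : {measure set (R * R) -> \bar R},
    measure_on (I `*` I) nu /\ sequential_decomposition I l1 l2 J nu.
Proof.
have [th [g [g0 chain]]] := shadow_chain l0 atoms_dominated.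
have stepE i : (i <= n)%N -> forall B, measurable B ->
    l2 B = \sum_(j < i) th j B + g i B.
  elim: i => [_ B mB|i IH iN B mB]; first by rewrite big_ord0 add0e g0.
  rewrite IH ?(ltnW iN)// big_ord_recr/= -addeA; congr (_ + _).
  by have [|_ [_ [_ ->]]] := chain i _; rewrite ?size_l.
have part (i : 'I_n) : [/\ forall B, measurable B ->
      g i B = l2 B - \sum_(j < n | (j < i)%N) th j B,
    measure_on I (g i), measure_on I (th i) &
    is_unique_connected_part_with I (g i) (l1 [set J i])
      (l1 [set J i] * (J i)%:E) (th i)].
  have [|[a [a0 aM thE]] [mean_th [ig gE]]] := chain i _; first by rewrite size_l.
  rewrite nth_l/= in aM thE mean_th.
  have geq B : measurable B -> g i B = l2 B - \sum_(j < n | (j < i)%N) th j B.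
    move=> mB; rewrite (stepE i (ltnW (ltn_ord i)))//.
    rewrite (big_ord_widen n (fun j => th j B) (ltnW (ltn_ord i))).
    rewrite addeAC subee ?add0e//.
    by apply/sum_fin_numP => k _ _; exact: fin_num_measure.
  have giI : measure_on I (g i).
    apply/eqP; rewrite -measure_le0; have <- : l2 (~` I) = 0 by exact: l2I.
    rewrite (stepE i (ltnW (ltn_ord i))); last exact: measurableC.
    by rewrite leeDr// sume_ge0.
  have thI : measure_on I (th i).
    apply/eqP; rewrite -measure_le0 -giI.
    by rewrite [leRHS]gE ?leeDl//; exact: measurableC.
  split => //.
  have wi0 := w0 i.
  have part : is_connected_part_with I (g i) (l1 [set J i])
      (l1 [set J i] * (J i)%:E) (th i).
    split.
    - exists a, (a + w i)%R; split => //; first by rewrite lerDl.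
        by rewrite measure_on_mass// lee_fin.
      apply: image_quantile_restriction => //; first by rewrite lerDl.
      by rewrite measure_on_mass// lee_fin.
    - have := measure_on_setI mI measurableT thI; rewrite setTI => thIT.
      rewrite wE; apply: etrans thIT _.
      rewrite (@image_quantile_setT _ (g i) a (a + w i)%R)//; last by rewrite lerDl.
      by rewrite addrAC subrr add0r.
    - rewrite wE -EFinM -mean_th; exact: measure_on_integral.
  split => // rho' rho'P B mB.
  exact: (connected_part_unique itvI oI I0 giI ig rho'P part).
(* The finite sum of measures takes a family over [nat]; the default of [nth] is met only beyond the
   [n] terms summed. *)
pose m (k : nat) : {measure set (R * R) -> \bar R} :=
  \d_((nth (0, 0)%R l k).2) \x th k.
pose nu : {measure set (R * R) -> \bar R} := msum m n.
have nuE B : measurable B -> nu B = \sum_(i < n) (\d_(J i) \x th i) B.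
  by move=> mB; rewrite /nu/= /msum; apply: eq_bigr => i _; rewrite /m nth_l.
exists nu; split.
  have mII : measurable (~` (I `*` I)) by apply: measurableC; exact: measurableX.
  rewrite /measure_on nuE// big1// => i _; rewrite dirac_prod1E//.
  have [_ _ thI _] := part i.
  apply: (@subset_measure0 _ _ _ (th i) _ (~` I)) => //.
  - exact: measurable_xsection.
  - exact: measurableC.
  - by move=> y; rewrite /xsection/= inE => nII Iy; apply: nII; split => //; exact: JI.
exists (fun i : 'I_n => th i); split => // i.
by exists (g i); have [? _ _ ?] := part i.
Qed.

(** If all earlier parts agree, so do the remainders, and the uniqueness clause of the next part
    applies; the bound [k] provides strong induction. *)
Lemma sequential_decomposition_unique (nu nu' : {measure set (R * R) -> \bar R}) :
  sequential_decomposition I l1 l2 J nu -> sequential_decomposition I l1 l2 J nu' ->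
  forall B, measurable B -> nu' B = nu B.
Proof.
move=> [th [nuE H]] [th' [nu'E H']] B mB.
have thE k : forall i : 'I_n, (i < k)%N -> forall A, measurable A -> th' i A = th i A.
  elim: k => // k IH i ik A mA.
  have [g [gE [gpart _]]] := H i.
  have [g' [g'E [_ g'uniq]]] := H' i.
  apply/esym/g'uniq => //; apply: eq_connected_part_with gpart => // C mC.
  rewrite [LHS]gE// [RHS]g'E//; congr (_ - _); apply: eq_bigr => j ji.
  by rewrite -IH// (leq_trans ji).
rewrite nuE// nu'E//; apply: eq_bigr => i _; rewrite !dirac_prod1E//.
by apply: (thE n) => //; exact: measurable_xsection.
Qed.

End existence.

Theorem proposition2p10 (R : realType) (I : set R)
    (l1 l2 : probability R R) (n : nat)
    (itvI : is_interval I) (openI : open I) (I_neq0 : I !=set0)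
    (l1I : measure_on I l1) (l2I : measure_on I l2)
    (mean1 : finite_mean l1) (mean2 : finite_mean l2)
    (finsupp : (supp I l1 #= `I_n)%card) :
  (forall nu : {measure set (R * R) -> \bar R}, measure_on (I `*` I) nu ->
     (curtain_martingale_coupling I l1 l2 nu <->
      exists J : 'I_n -> R,
        set_bij [set: 'I_n] (supp I l1) J /\
        sequential_decomposition I l1 l2 J nu)) /\
  (convex_order I l1 l2 ->
   forall J : 'I_n -> R, set_bij [set: 'I_n] (supp I l1) J ->
     exists nu : {measure set (R * R) -> \bar R},
       [/\ measure_on (I `*` I) nu,
           sequential_decomposition I l1 l2 J nu &
           forall nu' : {measure set (R * R) -> \bar R},
             measure_on (I `*` I) nu' ->
             sequential_decomposition I l1 l2 J nu' ->
             forall B : set (R * R), measurable B -> nu' B = nu B]).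
Proof.
have fs : finite_set (supp I l1) by exists n.
have s0 := measure_suppC openI l1I fs.
have bijE (J : 'I_n -> R) : set_bij [set: 'I_n] (supp I l1) J ->
    [/\ injective J, range J = supp I l1 & forall i, I (J i)].
  move=> [fJ iJ sJ]; split.
  - by move=> i j; apply: iJ; rewrite inE.
  - by apply/seteqP; split => [_ [i _ <-]|x /sJ//]; exact: fJ.
  - by move=> i; have [] := fJ i Logic.I.
split=> [nu nuI|ord J bijJ]; last first.
  have [Jinj rJ JI] := bijE _ bijJ.
  have l1J : l1 (~` range J) = 0 by rewrite rJ.
  have [nu [nuI nuD]] :=
    sequential_decomposition_exists itvI openI I_neq0 l1I l2I mean1 mean2 Jinj JI l1J ord.
  exists nu; split => // nu' _ nu'D.
  exact: (sequential_decomposition_unique itvI nuD nu'D).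
split; last first.
  move=> [J [bijJ [nu_ [nuE nu_part]]]].
  have [Jinj rJ JI] := bijE _ bijJ.
  have l1J : l1 (~` range J) = 0 by rewrite rJ.
  apply: (decomposition_curtain itvI openI I_neq0 l2I mean1 mean2 Jinj JI l1J nuI nuE).
  by move=> i; have [gamma [gammaE [gpart _]]] := nu_part i; exists gamma.
move=> [mart [Gamma [mGamma GammaI nuGamma cross]]].
(* Any enumeration of the support serves to begin with; the order extracted from [Gamma] then
   permutes it. *)
have /card_set_bijP[f [ff fi fsurj]] : (`I_n #= supp I l1)%card by rewrite card_eq_sym.
pose J0 (i : 'I_n) : R := f i.
have bijJ0 : set_bij [set: 'I_n] (supp I l1) J0.
  split.
  - by move=> i _; apply: ff => /=.
  - move=> i j _ _ /fi ij; apply: val_inj; apply: ij; rewrite inE/=; exact: ltn_ord.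
  - by move=> x /fsurj[k /= kn <-]; exists (Ordinal kn).
have [J0inj rJ0 J0I] := bijE _ bijJ0.
have [s sinj sP] := curtain_order J0inj cross.
pose J (i : 'I_n) : R := J0 (s i).
have bijJ : set_bij [set: 'I_n] (supp I l1) J.
  have [s' ss' s's] := injF_bij sinj.
  have [fJ0 _ sJ0] := bijJ0.
  split.
  - by move=> i _; exact: fJ0.
  - by move=> i j _ _ /J0inj/sinj.
  - by move=> x /sJ0[k _ <-]; exists (s' k) => //; rewrite /J s's.
have [Jinj rJ JI] := bijE _ bijJ.
have l1J : l1 (~` range J) = 0 by rewrite rJ.
have l1J_gt0 i : 0 < l1 [set J i].
  by apply: (supp_atom openI l1I fs); rewrite -rJ; exists i.
have [th thE] := slices_exist J mart.
exists J; split => //; exists th.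
exact: (slices_decomposition itvI openI I_neq0 Jinj l1J l1J_gt0 mart mGamma nuGamma sP thE).
Qed.
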